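(* Let $(T,\mathcal T,\lambda)$ be a complete, atomless probability space, $\mathcal F\subseteq\mathcal T$ a sub-$\sigma$-algebra, $A$ a nonempty compact metric space, and $(S,\mathcal S)$ an arbitrary measurable space. Assume that $\mathcal T$ is nowhere equivalent to $\mathcal F$. Then every $\mathcal F$-measurable large game with traits $G=(\alpha,v)$ (with agent space $(T,\mathcal T,\lambda)$, action space $A$ and trait space $(S,\mathcal S)$) has a $\mathcal T$-measurable pure-strategy Nash equilibrium; that is, there is a $\mathcal T$-measurable $f:T\to A$ such that for $\lambda$-a.e. $t\in T$, $$v_t\big(f(t),\lambda(\alpha,f)^{-1}\big)\ \ge\ v_t\big(a,\lambda(\alpha,f)^{-1}\big)\quad\text{for all }a\in A.$$
   Context: Nowhere equivalence: for $D\in\mathcal T$ put $\mathcal F^{D}:=\{D\cap E:\ E\in\mathcal F\}$. $\mathcal T$ is nowhere equivalent to $\mathcal F$ if for every $D\in\mathcal T$ with $\lambda(D)>0$ there exists a $\mathcal T$-measurable $D_0\subseteq D$ such that $\lambda(D_0\triangle D_1)>0$ for all $D_1\in\mathcal F^{D}$. Let $\mathcal M(S\times A)$ be the set of probability measures on $(S\times A,\mathcal S\otimes\mathcal B(A))$, where $\mathcal B(A)$ is the Borel $\sigma$-algebra of $A$. A Carathéodory function on $S\times A$ is $\varphi:S\times A\to\mathbb R$ such that $\varphi(\cdot,a)$ is $\mathcal S$-measurable for each $a\in A$ and $\varphi(s,\cdot)$ is continuous for each $s\in S$. Endow $\mathcal M(S\times A)$ with the coarsest topology making $\rho\mapsto\int_{S\times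 A}\varphi\,d\rho$ continuous for every bounded Carathéodory function $\varphi$. Let $\mathcal V_{(A,S)}:=C_b(A\times\mathcal M(S\times A))$ be the space of bounded continuous real functions on $A\times\mathcal M(S\times A)$, with the sup-norm topology and its Borel $\sigma$-algebra. A trait function is an $\mathcal F$-measurable map $\alpha:T\to S$. A game function is an $\mathcal F$-measurable map $v:T\to\mathcal V_{(A,S)}$ that is strongly $\mathcal F$-measurable, meaning that it is, $\lambda$-almost everywhere, the pointwise limit (in sup norm) of a sequence of $\mathcal F$-measurable countably-valued functions. Write $v_t:=v(t)$. A pair $G=(\alpha,v)$ of a trait function and a game function is called an $\mathcal F$-measurable large game with traits. $\lambda(\alpha,f)^{-1}\in\mathcal M(S\times A)$ denotes the pushforward of $\lambda$ under $t\mapsto(\alpha(t),f(t))$. *)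

(* Defs.v *)
From HB Require Import structures.
From mathcomp Require Import all_boot all_order all_algebra.
From mathcomp Require Import all_classical all_reals all_analysis.

Set Implicit Arguments.
Unset Strict Implicit.
Unset Printing Implicit Defensive.

Import Order.TTheory GRing.Theory Num.Theory.
Import numFieldNormedType.Exports.

Local Open Scope classical_set_scope.
Local Open Scope ring_scope.

(* A library [measurableType] carries a distinguished point, so a nonempty
   metric space is rendered by a pointed one; the point plays no other role. *)
#[short(type="pmetricType")]
HB.structure Definition PointedMetric (R : numDomainType) :=
  {M of Pointed M & Metric R M}.

Notation borel X := (g_sigma_algebraType (@open X)).

Section measures_on_traits_and_actions.
Context (R : realType) (dS : measure_display) (S : measurableType dS).
Context (A : pmetricType R).

Definition caratheodory (phi : S * A -> R) : Prop :=
  (forall a, measurable_fun [set: S] (fun s => phi (s, a))) /\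
  (forall s, continuous (fun a => phi (s, a))).

Definition bounded_caratheodory : Type :=
  {phi : S * A -> R | caratheodory phi /\ bounded_fun phi}.

Definition pmeasures : Type := probability (S * borel A)%type R.

HB.instance Definition _ := Choice.on pmeasures.

Definition caratheodory_integral (phi : bounded_caratheodory)
    (rho : pmeasures) : R :=
  \int[(rho : probability (S * borel A)%type R)]_x (sval phi x).

(* The coarsest topology making every [caratheodory_integral phi] continuous. *)
HB.instance Definition _ := Topological.copy pmeasures
  (sup_topology (fun phi : bounded_caratheodory =>
    Topological.class (initial_topology (caratheodory_integral phi)))).

End measures_on_traits_and_actions.

Section bounded_continuous_functions.
Context (R : realType) (X : topologicalType).

Record bcont : Type := BCont {
  bcont_fun :> X -> R;
  bcont_continuous : continuous bcont_fun;
  bcont_bounded : bounded_fun bcont_fun }.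

HB.instance Definition _ := gen_eqMixin bcont.
HB.instance Definition _ := gen_choiceMixin bcont.

Definition supnorm (h : X -> R) : R := sup (range (fun x => `|h x|)).

Definition bcont_dist (f g : bcont) : R := supnorm (fun x => f x - g x).

Let bound_range (f g : bcont) : has_ubound (range (fun x => `|f x - g x|)).
Proof.
have [M [_ fM]] := bcont_bounded f; have [N [_ gN]] := bcont_bounded g.
exists ((M + 1) + (N + 1)) => _ [x _ <-].
apply: (le_trans (ler_normB _ _)); apply: lerD.
- by apply: fM => //; rewrite ltrDl.
- by apply: gN => //; rewrite ltrDl.
Qed.

Let dist_ub (f g : bcont) x : `|f x - g x| <= bcont_dist f g.
Proof. by apply: ub_le_sup; [exact: bound_range|exists x]. Qed.

Let dist_le (f g : bcont) (c : R) : 0 <= c ->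
  (forall x, `|f x - g x| <= c) -> bcont_dist f g <= c.
Proof.
move=> c0 fgc; have [[x _]|X0] := pselect (exists x : X, True); last first.
  rewrite /bcont_dist /supnorm.
  rewrite (_ : range (fun x => `|f x - g x|) = set0) ?sup0//.
  by rewrite -subset0 => y [x _ _]; apply: X0; exists x.
by apply: ge_sup; [exists `|f x - g x|, x|move=> _ [y _ <-]].
Qed.

Let dist_ge0 (f g : bcont) : 0 <= bcont_dist f g.
Proof.
have [[x _]|X0] := pselect (exists x : X, True).
  by apply: (le_trans _ (dist_ub f g x)).
rewrite /bcont_dist /supnorm.
rewrite (_ : range (fun x => `|f x - g x|) = set0) ?sup0//.
by rewrite -subset0 => y [x _ _]; apply: X0; exists x.
Qed.

Let distxx (f : bcont) : bcont_dist f f = 0.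
Proof.
by apply/eqP; rewrite eq_le dist_ge0 andbT dist_le// => x; rewrite subrr normr0.
Qed.

Let dist_positivity (f g : bcont) : bcont_dist f g = 0 -> f = g.
Proof.
move=> fg0; have fg : bcont_fun f = bcont_fun g.
  apply/funext => x; apply/eqP; rewrite -subr_eq0 -normr_le0 -fg0.
  exact: dist_ub.
case: f g fg {fg0} => f cf bf [g cg bg] /= fg; subst g.
by congr BCont; exact: Prop_irrelevance.
Qed.

Let dist_sym (f g : bcont) : bcont_dist f g = bcont_dist g f.
Proof.
rewrite /bcont_dist /supnorm (_ : (fun x => `|f x - g x|) =
  (fun x => `|g x - f x|))//; by apply/funext => x; rewrite distrC.
Qed.

Let dist_triangle (g f h : bcont) :
  bcont_dist f h <= bcont_dist f g + bcont_dist g h.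
Proof.
apply: dist_le => [|x]; first by rewrite addr_ge0.
by rewrite (le_trans (ler_distD (g x) _ _))// lerD.
Qed.

HB.instance Definition _ := @isMetric.Build R bcont bcont_dist
  distxx dist_positivity dist_sym dist_triangle.

Let cst0_bounded : bounded_fun (fun _ : X => 0 : R).
Proof. by exists 0; split => // M M0 x _; rewrite normr0 ltW. Qed.

HB.instance Definition _ := isPointed.Build bcont
  (BCont (fun _ => @cvg_cst _ _ _ _ _) cst0_bounded).

End bounded_continuous_functions.

Record subsigma_algebra d (T : measurableType d) : Type := SubsigmaAlgebra {
  subsigma_sets :> set (set T);
  subsigmaP : sigma_algebra [set: T] subsigma_sets;
  subsigma_measurable : subsigma_sets `<=` measurable }.

Definition measurable_wrt (T : Type) (F : set (set T)) d'
    (Y : measurableType d') (f : T -> Y) : Prop :=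
  forall B, measurable B -> F (f @^-1` B).

Section large_games.
Context (R : realType) (d : measure_display) (T : measurableType d).
Variable lambda : probability T R.

Definition atomless : Prop := forall D, measurable D -> (0 < lambda D)%E ->
  exists E, [/\ measurable E, E `<=` D, (0 < lambda E)%E
              & (lambda E < lambda D)%E].

Definition nowhere_equivalent (F : set (set T)) : Prop :=
  forall D, measurable D -> (0 < lambda D)%E ->
    exists D0, [/\ measurable D0, D0 `<=` D &
      forall D1, [set D `&` E | E in F] D1 -> (0 < lambda (D0 `+` D1))%E].

Definition strongly_measurable_wrt (F : set (set T)) (X : topologicalType)
    (v : T -> bcont R X) : Prop :=
  exists w : nat -> T -> bcont R X,
    (forall n, measurable_wrt F (w n : T -> borel (bcont R X)) /\
               countable (range (w n))) /\
    {ae lambda, forall t, w n t @[n --> \oo] --> v t}.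

Variable F : subsigma_algebra T.
Context (dS : measure_display) (S : measurableType dS) (A : pmetricType R).

Local Notation V := (bcont R (A * pmeasures S A)%type).

Record large_game : Type := LargeGame {
  trait : T -> S;
  payoff : T -> V;
  trait_measurable : measurable_wrt F trait;
  payoff_measurable : measurable_wrt F (payoff : T -> borel V);
  payoff_strongly_measurable : strongly_measurable_wrt F payoff }.

Definition trait_action (G : large_game) (f : {mfun T >-> borel A}) (t : T) :
  S * borel A := (trait G t, f t).

Let measurable_trait_action (G : large_game) (f : {mfun T >-> borel A}) :
  measurable_fun [set: T] (trait_action G f).
Proof.
apply: measurable_fun_pair; last exact: measurable_funPT.
move=> _ B mB; rewrite setTI.
by apply/(subsigma_measurable (s := F))/trait_measurable.
Qed.

HB.instance Definition _ (G : large_game) (f : {mfun T >-> borel A}) :=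
  @isMeasurableFun.Build _ _ _ _ (trait_action G f)
    (measurable_trait_action G f).

Definition action_law (G : large_game) (f : {mfun T >-> borel A}) :
  pmeasures S A := distribution lambda (trait_action G f).

Definition pure_nash (G : large_game) (f : {mfun T >-> borel A}) : Prop :=
  {ae lambda, forall t, forall a : A,
    payoff G t (a, action_law G f) <= payoff G t (f t : A, action_law G f)}.

End large_games.

(* Main.v *)
Require Import Defs.
From HB Require Import structures.
From mathcomp Require Import all_boot all_order all_algebra.
From mathcomp Require Import all_classical all_reals all_analysis.
From mathcomp Require Import measurable_realfun.
From mathcomp Require Import ring lra.

Set Implicit Arguments.
Unset Strict Implicit.
Unset Printing Implicit Defensive.

(** Why an equilibrium exists.

    Let [pi] map the Cantor space continuously onto [A], and let a strategy
    be a measurable map [f] from agents to infinite binary words, played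
    through [pi].  Traits and payoffs are measurable with respect to the small
    sigma-algebra [F], so everything the game sees of [f] is contained in its
    weights: the masses of [cylinder f w `&` E], for [w] a finite word and [E]
    in [F].  Indeed the integral of a bounded payoff [u (t, pi (f t))], with
    [u] measurable with respect to [F] in [t] and continuous in the action, is
    a limit, uniform in [f], of linear combinations of weights
    ([affine_continuous_payoff]).

    Nowhere equivalence makes the set of all weight systems convex and compact,
    so that randomisation and limits never lead outside pure strategies.  The
    key is [maharam]: a set function on [F] that is additive and lies between 0
    and the mass of [D `&` E] is the mass of [B `&` E] for some measurable [B]
    inside [D].  It follows from [halving], where nowhere equivalence enters,
    by the Hahn decomposition and exhaustion.  Splitting sets this way down the
    binary tree turns any consistent additive weight system into an actual
    strategy ([realization]); mixtures of weights and limits of weights along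
    an ultrafilter are such systems ([mixture_exists], [ultra_converges]).

    When all agents follow [f], a strategy [h] earns [value f h], the integral
    of normalised payoffs against the law of traits and actions under [f].
    This is continuous and affine in [h].  It is also continuous in [f]
    uniformly in [h] ([value_equicontinuous]): strong measurability leaves,
    outside a set of small mass, finitely many payoff functions up to a small
    error, and compactness of [A] makes each of these vary uniformly in the
    action.  Convexity and compactness then give some [f] that maximises
    [value f] ([compact_convex_equilibrium]).  Its finite-dimensional core,
    [simplex_equilibrium], has the strength of Brouwer's theorem and is proved
    by Scarf's parity argument on linear orders ([fully_coloured_dominant]).

    If [f] maximises [value f], switching to the action [pi (pad w)] exactly
    where this is strictly better cannot help, so it is strictly better on a
    null set only.  The actions [pi (pad w)] form a countable dense set and
    payoffs are continuous, so almost every agent plays a best response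
    ([equilibrium_pure_nash]). *)

(** * Dominant sets for a family of linear orders *)

(** Each [i] orders the finite set [V] by the injective rank [k i].  The
    argument is the one of Scarf: dominant sets with as many elements as there
    are orders play the part of the top simplices of a triangulation, and those
    with one element less the part of its facets. *)
Section dominance.
Variables (I V : finType) (k : I -> V -> nat).
Hypothesis k_inj : forall i, injective (k i).

Definition dominant (X : {set V}) :=
  [forall y, exists i, [forall x in X, k i y <= k i x]].

Lemma dominantP (X : {set V}) :
  reflect (forall y, exists i, forall x, x \in X -> k i y <= k i x)
          (dominant X).
Proof.
apply: (iffP forallP) => H y; have := H y.
- by move=> /existsP[i /forall_inP]; exists i.
- by move=> [i Hi]; apply/existsP; exists i; apply/forall_inP.
Qed.

Lemma dominantS (X Y : {set V}) : X \subset Y -> dominant Y -> dominant X.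
Proof.
move=> XY /dominantP Yd; apply/dominantP => y; have [i Hi] := Yd y.
by exists i => x /(fintype.subsetP XY); exact: Hi.
Qed.

(** The slack vertex [s i] is lowest for the order [i] and above all proper
    vertices for the other orders.  Slack vertices stand for the walls of the
    simplex: containing [s i] amounts to ignoring the order [i]. *)
Variables (s : I -> V) (c : V -> I) (t0 : V).
Hypothesis s_lowest : forall i y, y != s i -> k i (s i) < k i y.
Hypothesis s_high : forall i j y, i != j -> (forall l, y != s l) ->
  k i y < k i (s j).
Hypothesis c_s : forall i, c (s i) = i.
Hypothesis t0_nslack : forall l, t0 != s l.

Lemma slack_inj : injective s.
Proof. by move=> i j /(congr1 c); rewrite !c_s. Qed.

Section two_fillings.
Variable X : {set V}.
Hypotheses (Xd : dominant X) (cardX : #|X|.+1 = #|I|).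
Variable t : V.
Hypotheses (tX : t \in X) (t_nslack : forall l, t != s l).

Let m i := [arg min_(x < t in X) k i x].

Let mX i : m i \in X.
Proof. by rewrite /m; case: arg_minnP. Qed.

Let m_min i x : x \in X -> k i (m i) <= k i x.
Proof. by move=> xX; rewrite /m; case: arg_minnP => // y _; apply. Qed.

Let m_surj x : x \in X -> exists i, m i = x.
Proof.
move=> xX; have [i Hi] := dominantP _ Xd x; exists i; apply: (@k_inj i).
by apply/eqP; rewrite eqn_leq m_min// Hi.
Qed.

(** Two orders share their minimum on [X], since [X] is one element short of
    the number of orders and each of its elements is a minimum.  A new element
    must take over the minimum of one of these two, so it has to beat all other
    minima, and to be the largest such element in the order it takes over. *)
Let above i := [set y | [forall l, (l != i) ==> (k l (m l) < k l y)]].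

Let aboveP i y :
  reflect (forall l, l != i -> k l (m l) < k l y) (y \in above i).
Proof. by rewrite inE; apply: (iffP forallP) => H l; have /implyP := H l. Qed.

Let slack_above i : s i \in above i.
Proof.
by apply/aboveP => l li; apply: (leq_ltn_trans (m_min l tX)); exact: s_high.
Qed.

Let top i := [arg max_(y > s i in above i) k i y].

Let top_above i : top i \in above i.
Proof. by rewrite /top; case: arg_maxnP. Qed.

Let top_max i z : z \in above i -> k i z <= k i (top i).
Proof. by move=> zA; rewrite /top; case: arg_maxnP => // y _; apply. Qed.

Let above_le i y : y \in above i -> k i y <= k i (m i).
Proof.
move=> /aboveP yA; have [l Hl] := dominantP _ Xd y.
have [<-|li] := eqVneq l i; first exact: Hl.
by have := yA l li; rewrite ltnNge Hl.
Qed.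

Let top_dominant i : dominant (top i |: X).
Proof.
apply/dominantP => z; have [zA|] := boolP (z \in above i).
  exists i => x /setU1P[->|xX]; first exact: top_max.
  rewrite (leq_trans (top_max zA))// (leq_trans (above_le (top_above i)))//.
  exact: m_min.
rewrite inE negb_forall => /existsP[l]; rewrite negb_imply -leqNgt.
move=> /andP[li zl]; exists l => x /setU1P[->|xX].
  by rewrite (leq_trans zl)// ltnW//; exact: (aboveP _ _ (top_above i)).
by rewrite (leq_trans zl)// m_min.
Qed.

(** The analogue of an inner facet lying in exactly two simplices. *)
Lemma card_fillings : #|[set y | (y \notin X) && dominant (y |: X)]| = 2.
Proof.
have mT : m @: [set: I] = X.
  apply/finset.setP => x; apply/imsetP/idP => [[i _ ->]//|/m_surj[i <-]].
  by exists i.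
have [i [j [ij mij]]] : exists i j, i != j /\ m i = m j.
  (* pigeonhole: [m] maps [I] onto [X], which has one element less *)
  have : ~ injective m.
    move=> mI; have := card_imset [set: I] mI.
    by rewrite mT cardsT -cardX => /n_Sn.
  move=> mI; have [/existsP[i /existsP[j /andP[ij /eqP mij]]]|] :=
    boolP [exists i, exists j, (i != j) && (m i == m j)]; first by exists i, j.
  rewrite negb_exists => /forallP H; case: mI => i j mij; apply/eqP.
  have := H i; rewrite negb_exists => /forallP/(_ j).
  by rewrite mij eqxx andbT negbK.
have m_inj l l' : l != i -> l' != i -> m l = m l' -> l = l'.
  have : #|m @: [set~ i]| = #|[set~ i]|.
    rewrite (_ : m @: _ = X); first by rewrite cardsC1 -cardX.
    apply/finset.setP => x; apply/imsetP/idP => [[n _ ->]//|/m_surj[n <-]].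
    have [->|ni] := eqVneq n i; last by exists n => //; rewrite !inE.
    by exists j => //; rewrite !inE eq_sym.
  move=> /eqP/imset_injP mI li l'i; by apply: mI; rewrite !inE.
have m_only l l' : m l = m l' -> l' != i -> l' != j -> l = l'.
  move=> mll' l'i l'j; have [li|li] := eqVneq l i; last exact: m_inj.
  case/eqP: l'j; apply/esym/m_inj; rewrite // 1?eq_sym//.
  by rewrite -mij -li.
have not_both y : y \in above i -> y \in above j -> False.
  move=> /aboveP yi /aboveP yj; have [l Hl] := dominantP _ Xd y.
  have : k l (m l) < k l y.
    by have [->|/yi//] := eqVneq l i; apply: yj.
  by rewrite ltnNge Hl.
have above_nX l l' y : l != l' -> m l = m l' -> y \in above l -> y \notin X.
  move=> ll' mll' /aboveP yA; apply/negP => /m_surj[n nm].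
  have [nl|/yA] := eqVneq n l; last by rewrite nm ltnn.
  by have := yA l'; rewrite eq_sym ll' -mll' -nl nm ltnn => /(_ isT).
suff -> : [set y | (y \notin X) && dominant (y |: X)] = [set top i; top j].
  rewrite cards2; case: eqVneq => // tij.
  by case: (@not_both (top i)) => //; rewrite tij.
apply/finset.setP => y; rewrite !inE; apply/idP/idP; last first.
  move=> /orP[]/eqP->; rewrite top_dominant andbT.
    exact: (above_nX i j).
  by apply: (above_nX j i); rewrite // eq_sym.
move=> /andP[yX yd].
(* adding [y] must leave every element of [X] minimal for some order *)
have stay x : x \in X -> exists2 l, m l = x & k l x < k l y.
  move=> xX; have [l Hl] := dominantP _ yd x; exists l.
    apply: (@k_inj l); apply/eqP; rewrite eqn_leq m_min//=.
    by apply: Hl; rewrite !inE mX orbT.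
  rewrite ltn_neqAle Hl ?finset.setU11// andbT (inj_eq (@k_inj l)).
  by apply: contraNneq yX => <-.
have keep l : l != i -> l != j -> k l (m l) < k l y.
  move=> li lj; have [l' ml'] := stay _ (mX l).
  by rewrite (m_only _ _ ml')// -ml'.
have is_top l : y \in above l -> y = top l.
  move=> yA; apply: (@k_inj l); apply/eqP; rewrite eqn_leq top_max//=.
  have [n Hn] := dominantP _ yd (top l).
  have [nl|nl] := eqVneq n l; first by rewrite nl in Hn; rewrite Hn ?finset.setU11.
  have := aboveP _ _ (top_above l) n nl.
  by rewrite ltnNge Hn// !inE mX orbT.
have [l ml ly] := stay _ (mX i); have [li|li] := eqVneq l i.
  apply/orP; right; apply/eqP/is_top/aboveP => n nj.
  have [->|ni] := eqVneq n i; last exact: keep.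
  by rewrite li in ly.
have lj : l = j by apply: m_inj; rewrite ?ml ?mij// eq_sym.
apply/orP; left; apply/eqP/is_top/aboveP => n ni.
by have [->|nj] := eqVneq n j; [rewrite -mij -lj|exact: keep].
Qed.

End two_fillings.

(** The one boundary facet: all slack vertices but one.  The other slack vertex
    would make the set beatable by any proper vertex, so the only completion is
    by the proper vertex that is largest for the remaining order. *)
Lemma card_fillings_slack i0 :
  #|[set y | (y \notin s @: [set~ i0]) && dominant (y |: s @: [set~ i0])]| = 1.
Proof.
pose ns := [pred y | [forall l, y != s l]].
have nsP y : reflect (forall l, y != s l) (ns y) by exact: forallP.
have ns_t0 : ns t0 by apply/nsP.
pose top := [arg max_(y > t0 | ns y) k i0 y].
have [ns_top top_max] : ns top /\ forall z, ns z -> k i0 z <= k i0 top.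
  by rewrite /top; case: arg_maxnP.
suff -> : [set y | (y \notin s @: [set~ i0]) && dominant (y |: s @: [set~ i0])]
    = [set top] by rewrite cards1.
apply/finset.setP => y; rewrite !inE; apply/idP/eqP => [/andP[yX /dominantP yd]|->].
  have ns_y : ns y.
    apply/nsP => l; apply/eqP => yl; have [li|li] := eqVneq l i0; last first.
      by move: yX; rewrite yl imset_f// !inE.
    have [i Hi] := yd t0; have := s_lowest (t0_nslack i).
    rewrite ltnNge Hi//; have [->|ii0] := eqVneq i i0.
      by rewrite -li -yl finset.setU11.
    by rewrite !inE imset_f ?orbT// !inE.
  apply: (@k_inj i0); apply/eqP; rewrite eqn_leq top_max//=.
  have [i Hi] := yd top; have [ii0|ii0] := eqVneq i i0.
    by rewrite ii0 in Hi; rewrite Hi ?finset.setU11.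
  have /nsP/(_ i)/s_lowest := ns_top.
  by rewrite ltnNge Hi// !inE imset_f ?orbT// !inE.
apply/andP; split.
  by apply/negP => /imsetP[i _] /eqP; apply/negP; exact: (nsP _ ns_top).
apply/dominantP => z; have [ns_z|] := boolP (ns z).
  exists i0 => x /setU1P[->|/imsetP[j]]; first exact: top_max.
  by rewrite !inE => ji0 ->; rewrite ltnW// s_high//; [rewrite eq_sym|apply/nsP].
rewrite negb_forall => /existsP[i]; rewrite negbK => /eqP->.
exists i => x _; have [->//|/s_lowest/ltnW//] := eqVneq x (s i).
Qed.

Let card_setD1 (R : {set V}) y : y \in R -> #|R :\ y|.+1 = #|R|.
Proof. by move=> yR; rewrite (cardsD1 y R) yR. Qed.

(** A set that carries all colours loses exactly [i0] in one way.  If it already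
    lacks [i0], one colour occurs twice and either of its two bearers can be
    dropped. *)
Lemma card_facets (R : {set V}) i0 :
  #|R| = #|I| -> [set~ i0] \subset c @: R ->
  odd #|[set y in R | c @: (R :\ y) == [set~ i0]]| = (c @: R == [set: I]).
Proof.
move=> cardR sub; have [cT|cT] := eqVneq (c @: R) [set: I].
  have cI : {in R &, injective c} by apply/imset_injP; rewrite cT cardsT cardR.
  have /imsetP[x xR cx] : i0 \in c @: R by rewrite cT inE.
  suff -> : [set y in R | c @: (R :\ y) == [set~ i0]] = [set x].
    by rewrite cards1.
  apply/finset.setP => y; rewrite !inE; apply/andP/eqP => [[yR /eqP cy]|->].
    apply/eqP; rewrite eq_sym; apply: contraT => xy.
    have : c x \in c @: (R :\ y) by rewrite imset_f// !inE xy.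
    by rewrite cy !inE -cx eqxx.
  split=> //; apply/eqP/finset.setP => l; rewrite !inE; apply/imsetP/idP.
    move=> [z]; rewrite !inE => /andP[zx zR] ->.
    by rewrite cx; apply: contraNneq zx => /cI->.
  have /imsetP[z zR ->] : l \in c @: R by rewrite cT inE.
  move=> czi0; exists z => //; rewrite !inE zR andbT.
  by apply: contraNneq czi0 => ->; rewrite cx.
have cR : c @: R = [set~ i0].
  apply/eqP; rewrite finset.eqEsubset sub andbT; apply/fintype.subsetP => l lR.
  rewrite !inE; apply: contraNneq cT => li0; rewrite -finset.subTset.
  apply/fintype.subsetP => l' _.
  have [->|l'i0] := eqVneq l' i0; first by rewrite -li0.
  by apply: (fintype.subsetP sub); rewrite !inE.
have [a [b [aR bR ab cab]]] : exists a b, [/\ a \in R, b \in R, a != b & c a = c b].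
  have [H|] := boolP [exists a in R, exists b in R, (a != b) && (c a == c b)].
    move: H => /exists_inP[a aR /exists_inP[b bR /andP[ab /eqP cab]]].
    by exists a, b.
  rewrite negb_exists => /forallP H; exfalso.
  have : #|c @: R| = #|R|.
    apply: card_in_imset => a b aR bR cab; apply/eqP.
    have := H a; rewrite aR /= negb_exists => /forallP/(_ b).
    by rewrite bR cab eqxx andbT negbK.
  rewrite cR cardR cardsC1; have := max_card (pred1 i0).
  by rewrite card1; case: #|I| => // n _ /n_Sn.
have image_drop x y : x \in R -> y \in R -> x != y -> c x = c y ->
    c @: (R :\ x) = [set~ i0].
  move=> xR yR xy cxy; rewrite -cR; apply/finset.setP => l.
  apply/imsetP/imsetP => -[z]; first by rewrite !inE => /andP[_ zR] ->; exists z.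
  move=> zR ->; have [->|zx] := eqVneq z x; last by exists z; rewrite // !inE zx.
  by exists y; rewrite // !inE eq_sym xy.
have cI : {in R :\ a &, injective c}.
  apply/imset_injP; rewrite (image_drop a b)// cardsC1.
  by have := card_setD1 aR; rewrite cardR => <-.
suff -> : [set y in R | c @: (R :\ y) == [set~ i0]] = [set a; b].
  by rewrite cards2 ab.
apply/finset.setP => y; rewrite !inE; apply/andP/orP => [[yR /eqP cy]|]; last first.
  case=> /eqP->; split => //; apply/eqP; first exact: (image_drop a b).
  by apply: (image_drop b a) => //; rewrite eq_sym.
have [|ya] := eqVneq y a; first by left.
right; have : c y \in c @: (R :\ y) by rewrite cy -cR imset_f.
move=> /imsetP[z]; rewrite !inE => /andP[zy zR] cyz.
have [za|za] := eqVneq z a.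
  by apply/eqP/cI; rewrite ?inE ?ya// 1?eq_sym ?ab// cyz za.
by move: zy; rewrite (cI z y)// ?inE ?za ?ya// eqxx.
Qed.

(** Doors are dominant sets with one element less than there are colours that
    show every colour but [i0]; rooms are their dominant one-element extensions.
    Every door leads to two rooms, except the slack door, which leads to one, so
    the number of door-room incidences is odd.  A room has an odd number of
    doors only when it is fully coloured, hence such a room exists. *)
Theorem fully_coloured_dominant :
  exists X : {set V}, [/\ dominant X, #|X| = #|I| & c @: X = [set: I]].
Proof.
have i0 := c t0.
pose door (X : {set V}) :=
  [&& dominant X, #|X|.+1 == #|I| & c @: X == [set~ i0]].
pose room (R : {set V}) :=
  [&& dominant R, #|R| == #|I| & [set~ i0] \subset c @: R].
have double_count :
    \sum_(X | door X) #|[set y | (y \notin X) && dominant (y |: X)]| =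
    \sum_(R | room R) #|[set y in R | c @: (R :\ y) == [set~ i0]]|.
  have E (P : pred {set V}) (Q : {set V} -> pred V) :
      \sum_(X | P X) #|[set y | Q X y]| = \sum_y \sum_(X | P X && Q X y) 1.
    rewrite (exchange_big_dep P) /=; last by move=> y X _ /andP[].
    apply: eq_bigr => X PX; rewrite -sum1_card.
    by apply: eq_bigl => y; rewrite inE PX.
  rewrite !E; apply: eq_bigr => y _.
  rewrite (reindex_onto (fun R => R :\ y) (fun X => y |: X)) /=; last first.
    by move=> X /andP[_ /andP[yX _]]; rewrite finset.setU1K.
  apply: eq_bigl => R; rewrite setD11 /=.
  have [yR|yR] := boolP (y \in R); last first.
    rewrite andbF; apply/negbTE; apply: contraNN yR => /andP[_ /eqP <-].
    by rewrite finset.setU11.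
  rewrite finset.setD1K// eqxx andbT /door /room (card_setD1 yR).
  rewrite -!andbA; apply/and4P/and4P => -[].
    move=> _ cR cRy dR; split=> //; rewrite -(eqP cRy).
    by apply: imsetS; rewrite finset.subsetDl.
  by move=> dR cR _ cRy; split=> //; apply: dominantS dR; rewrite finset.subsetDl.
have cardI : #|[set~ i0]|.+1 = #|I|.
  by rewrite cardsC1 prednK//; apply/card_gt0P; exists i0.
have slack_door : door (s @: [set~ i0]).
  apply/and3P; split; last 1 first.
  - apply/eqP/finset.setP => l; apply/imsetP/idP => [[_ /imsetP[j ji0 ->] ->]|li0].
      by rewrite c_s.
    by exists (s l); rewrite ?c_s// imset_f.
  - have : 0 < #|[set y | (y \notin s @: [set~ i0]) &&
        dominant (y |: s @: [set~ i0])]| by rewrite card_fillings_slack.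
    move=> /card_gt0P[y]; rewrite inE => /andP[_].
    by apply: dominantS; exact: finset.subsetUr.
  - by rewrite (card_imset _ slack_inj) cardI.
have odd_doors :
    odd (\sum_(X | door X) #|[set y | (y \notin X) && dominant (y |: X)]|).
  rewrite (bigD1 (s @: [set~ i0]))//= card_fillings_slack oddD /=.
  rewrite (eq_bigr (fun=> 2)) ?sum_nat_const ?oddM ?andbF//.
  move=> X /andP[/and3P[dX /eqP cardX /eqP cX] Xs].
  have [/exists_inP[t tX /forallP t_ns]|] :=
    boolP [exists t in X, [forall l, t != s l]].
    exact: (card_fillings dX cardX tX).
  rewrite negb_exists => /forallP Xslack; case/eqP: Xs.
  have Xs x : x \in X -> s (c x) = x.
    move=> xX; have := Xslack x; rewrite xX /= negb_forall => /existsP[l].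
    by rewrite negbK => /eqP->; rewrite c_s.
  rewrite -cX; apply/finset.setP => x; apply/idP/imsetP.
    by move=> xX; exists (c x); rewrite ?Xs// imset_f.
  by move=> [_ /imsetP[z zX ->] ->]; rewrite Xs.
move: odd_doors; rewrite double_count.
have [/existsP[R /and3P[Rd /eqP cardR /eqP cR]]|] :=
    boolP [exists R, [&& dominant R, #|R| == #|I| & c @: R == [set: I]]].
  by exists R.
rewrite negb_exists => /forallP no_full; rewrite (big_morph odd oddD erefl).
rewrite big1// => R /and3P[Rd /eqP cardR sub].
rewrite card_facets//; apply/negbTE.
by have := no_full R; rewrite Rd cardR eqxx.
Qed.

End dominance.

(** * Equilibria on a simplex *)

Section grid.
Variables (I : finType) (i0 : I) (m : nat).
Local Notation point := {q : {ffun I -> 'I_m.+1} | \sum_i q i == m}.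
Local Notation vertex := (point + I)%type.

Let point_of (q : I -> nat) : \sum_i q i = m ->
  {p : point | forall i, val p i = q i :> nat}.
Proof.
move=> qm; pose p := [ffun i => inord (q i) : 'I_m.+1].
have pE i : p i = q i :> nat.
  by rewrite ffunE inordK// ltnS -qm (bigD1 i)//= leq_addr.
have pm : \sum_i p i == m by rewrite (eq_bigr _ (fun i _ => pE i)) qm.
by exists (exist _ p pm) => i /=; exact: pE.
Qed.

(** Proper vertices are the grid points of the simplex of total [m], compared
    in the order [i] by their coordinate [i]; ties are broken by enumeration. *)
Let height i (v : vertex) : nat := if v is inl p then val p i else m.+1.

Let rank i (v : vertex) : nat :=
  if v == inr i then 0 else (height i v * #|{: vertex}| + enum_rank v).+1.

Let rank_inj i : injective (rank i).
Proof.
move=> v w; rewrite /rank.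
case: eqP => [->|_]; case: eqP => [->|_] //= [].
move=> /(congr1 (modn^~ #|{: vertex}|)); rewrite !modnMDl !modn_small//.
by move=> /val_inj/enum_rank_inj.
Qed.

Let rank_lt i v w : w != inr i -> height i v < height i w -> rank i v < rank i w.
Proof.
move=> /negbTE wi vw; rewrite /rank wi; case: eqP => // _; rewrite ltnS.
rewrite (@leq_trans ((height i v).+1 * #|{: vertex}|))//.
  by rewrite mulSn addnC ltn_add2r.
by rewrite (leq_trans _ (leq_addr _ _))// leq_mul2r vw orbT.
Qed.

(** Let [low i] be the least coordinate [i] in a fully coloured dominant set, or
    0 if its slack vertex [inr i] is present.  No grid point exceeds all the
    [low i], so these almost add up to [m] and every grid point of the set lies
    within [#|I|] of [low].  A coordinate of [q0] that is at least [#|I|] rules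
    out the slack vertex, so its colour is borne by a grid point. *)
Lemma grid_near_coloring (c : {ffun I -> 'I_m.+1} -> I) :
  exists2 q0 : {ffun I -> 'I_m.+1}, \sum_i q0 i = m &
    forall i, #|I| <= q0 i -> exists2 q : {ffun I -> 'I_m.+1}, \sum_i q i = m &
      c q = i /\ forall j, q j <= q0 j + #|I| /\ q0 j <= q j + #|I|.
Proof.
pose col (v : vertex) := match v with inl p => c (val p) | inr i => i end.
have [t0 _] : {p : point | forall i, val p i = (if i == i0 then m else 0) :> nat}.
  by apply: point_of; rewrite -big_mkcond big_pred1_eq.
have [||//|//|X [Xd cardX Xcol]] :=
  @fully_coloured_dominant I vertex rank rank_inj inr col (inl t0).
- by move=> i v vi; rewrite /rank eqxx (negbTE vi).
- move=> i j [p|l] ij vs; last by have /eqP := vs l.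
  apply: rank_lt => /=; last exact: ltn_ord.
  by apply/eqP => -[ji]; rewrite ji eqxx in ij.
have no_slack i v : inr i \in X -> v != inr i ->
    ~ (forall x, x \in X -> rank i v <= rank i x).
  by move=> iX vi /(_ _ iX); rewrite /rank eqxx (negbTE vi).
have [p0 p0X] : exists p, inl p \in X.
  have [/existsP//|] := boolP [exists p, inl p \in X].
  rewrite negb_exists => /forallP noX; have [i Hi] := dominantP _ _ Xd (inl t0).
  have /imsetP[[p|l] xX] : i \in col @: X by rewrite Xcol inE.
    by have := noX p; rewrite xX.
  by move=> /= il; case: (@no_slack i (inl t0)); rewrite // il.
pose low i : nat := if inr i \in X then 0 else
  val [arg min_(p < p0 | inl p \in X) val p i] i.
have low_le i p : inl p \in X -> low i <= val p i.
  rewrite /low; case: ifP => // _ pX; case: arg_minnP => //= q _; exact.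
have low_big : m < \sum_i low i + #|I|.
  rewrite ltnNge; apply/negP => sum_le.
  have sumS : \sum_i (low i).+1 = \sum_i low i + #|I|.
    by rewrite -sum1_card -big_split; apply: eq_bigr => i _; rewrite /= addn1.
  (* a grid point above all minima, the excess being put on [i0] *)
  have [|y yE] := @point_of (fun i => (low i).+1 +
      if i == i0 then m - (\sum_i low i + #|I|) else 0).
    by rewrite big_split /= -big_mkcond big_pred1_eq sumS subnKC.
  have [i Hi] := dominantP _ _ Xd (inl y).
  have [iX|iX] := boolP (inr i \in X); first by case: (@no_slack i (inl y)).
  have [p pX low_p] : exists2 p, inl p \in X & low i = val p i.
    by rewrite /low (negbTE iX); case: arg_minnP => // p pX _; exists p.
  have := Hi _ pX; rewrite leqNgt => /negP; apply.
  by apply: rank_lt => //=; rewrite yE -low_p ltn_addr.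
have high i p : inl p \in X -> val p i < low i + #|I|.
  move=> pX; rewrite ltnNge; apply/negP => le_p; move: low_big.
  rewrite -{1}(eqP (valP p)) ltnNge => /negP; apply.
  rewrite (bigD1 i)//= [X in _ <= X](bigD1 i)//= addnAC leq_add//.
  by apply: leq_sum => j _; exact: low_le.
exists (val p0) => [|i Ii]; first exact/eqP/(valP p0).
have /imsetP[[p|l] xX /= E] : i \in col @: X by rewrite Xcol inE.
  exists (val p); first exact/eqP/(valP p).
  split=> // j; split.
    by rewrite (leq_trans (ltnW (high j _ xX)))// leq_add2r low_le.
  by rewrite (leq_trans (ltnW (high j _ p0X)))// leq_add2r low_le.
by have := high i _ p0X; rewrite /low E xX add0n ltnNge -E Ii.
Qed.
End grid.

Import Order.TTheory GRing.Theory Num.Theory.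
Import numFieldNormedType.Exports.

Local Open Scope classical_set_scope.
Local Open Scope ring_scope.

Definition simplex {R : realType} {n} : set 'rV[R]_n :=
  [set x | (forall i, 0 <= x 0 i) /\ \sum_i x 0 i = 1].

Lemma compact_simplex (R : realType) n : compact (@simplex R n).
Proof.
have cube := @rV_compact R n (fun=> `[0, 1]%classic)
  (fun=> @segment_compact _ 0 1).
apply: (subclosed_compact _ cube).
  rewrite (_ : simplex = (\bigcap_(i : 'I_n) ((fun x : 'rV[R]_n => x 0 i) @^-1`
      [set y | 0 <= y])) `&` (fun x : 'rV[R]_n => \sum_i x 0 i) @^-1` [set 1]).
    apply: closedI; [apply: closed_bigI => i _|]; apply: preimage_closed.
    - by move=> x _; exact: coord_continuous.
    - exact: closed_ge.
    - move=> x _; apply: (@cvg_big _ _ _ _ _ _ _ (nbhs x)) => [|i _].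
        exact: add_continuous.
      exact: coord_continuous.
    - exact: closed_eq.
  by apply/seteqP; split => [x [x0 x1]|x [x0 x1]]; split => // i;
    [move=> _; exact: x0|exact: x0].
move=> x [x0 x1] i /=; rewrite in_itv/= x0 -x1.
by rewrite (bigD1 i)//= lerDl sumr_ge0.
Qed.

(** Colour each point of a fine grid by a best reply.  By [grid_near_coloring]
    there are points [x m] such that each non-negligible coordinate of [x m] is
    a best reply at some point close to [x m]; any cluster point of these is an
    equilibrium. *)
Lemma simplex_equilibrium (R : realType) n (g : 'I_n.+1 -> 'rV[R]_n.+1 -> R) :
  (forall i x, simplex x -> forall e : R, 0 < e -> exists2 d : R, 0 < d &
    forall y, simplex y -> (forall j, `|x 0 j - y 0 j| < d) ->
      `|g i x - g i y| < e) ->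
  exists2 x, simplex x & forall i j, 0 < x 0 i -> g j x <= g i x.
Proof.
move=> gC.
pose pt m (q : {ffun 'I_n.+1 -> 'I_m.+2}) : 'rV[R]_n.+1 :=
  \row_i ((q i)%:R / m.+1%:R).
have pt_simplex m (q : {ffun 'I_n.+1 -> 'I_m.+2}) :
    (\sum_i q i = m.+1)%N -> simplex (@pt m q).
  move=> qm; split=> [i|]; first by rewrite mxE divr_ge0.
  under eq_bigr do rewrite mxE.
  by rewrite -mulr_suml -natr_sum qm divff// pnatr_eq0.
pose best (x : 'rV[R]_n.+1) := [arg max_(i > ord0 | true) g i x]%O.
have bestP x j : g j x <= g (best x) x.
  by rewrite /best; case: Order.TotalTheory.arg_maxP => // i _; apply.
have approx m : exists2 x, simplex x & forall i,
    n.+1%:R / m.+1%:R <= x 0 i -> exists2 y, simplex y &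
    (forall j, g j y <= g i y) /\
    forall j, `|x 0 j - y 0 j| <= n.+1%:R / m.+1%:R.
  have [q qm qP] := @grid_near_coloring _ ord0 m.+1 (fun q => best (pt m q)).
  exists (pt m q); first exact: pt_simplex.
  move=> i; rewrite mxE ler_pM2r ?invr_gt0 ?ltr0n// ler_nat => iq.
  have [|r rm [ri rq]] := qP i; first by rewrite card_ord.
  exists (pt m r); first exact: pt_simplex.
  split=> j; first by rewrite -ri bestP.
  rewrite !mxE -mulrBl normrM [X in _ * X]ger0_norm ?invr_ge0//.
  rewrite ler_pM2r ?invr_gt0 ?ltr0n// ler_distl lerBlDr.
  by have [] := rq j; rewrite card_ord -!natrD !ler_nat => -> ->.
have {approx} [x xSP] := choice (fun m => (exists2P _ _).1 (approx m)).
have xS m := (xSP m).1; have xP m := (xSP m).2.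
have [|p [pS pcl]] := @compact_simplex R n.+1 (x @ \oo) _.
  by exists 0%N => // m _; exact: xS.
exists p => // i j pi0; apply/ler_addgt0Pr => e e0.
have [|di di0 Hi] := gC i p pS (e / 2); first by rewrite divr_gt0.
have [|dj dj0 Hj] := gC j p pS (e / 2); first by rewrite divr_gt0.
pose d := Num.min (Num.min di dj) (p 0 i); have d0 : 0 < d.
  by rewrite !lt_min di0 dj0.
have mesh : \forall m \near \oo, n.+1%:R / m.+1%:R < d / 2.
  near=> m; rewrite ltr_pdivrMr// -ltr_pdivrMl ?divr_gt0//.
  rewrite (@lt_le_trans _ _ m%:R) ?ler_nat//.
  by near: m; exact: nbhs_infty_gtr.
have [xm [[m /= md <-]]] : [set x m | m in [set m | n.+1%:R / m.+1%:R < d / 2]]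
    `&` ball p (d / 2) !=set0.
  apply: pcl; last by apply: nbhsx_ballx; rewrite divr_gt0.
  by apply: filterS mesh => m md; exists m.
move=> pxm.
have {}pxm l : `|p 0 l - x m 0 l| < d / 2 by case: pxm => _; exact.
have [|y yS [gy xy]] := xP m i.
  have := pxm i; rewrite ltr_distlC => /andP[+ _].
  move=> /ltW; apply: le_trans; apply: (le_trans (ltW md)).
  rewrite lerBrDr -splitr /d ge_min lexx orbT//.
have py l : `|p 0 l - y 0 l| < d.
  rewrite (le_lt_trans (ler_distD (x m 0 l) _ _))//.
  by rewrite [ltRHS]splitr ltr_leD// (le_trans (xy l))// ltW.
have pyi l : `|p 0 l - y 0 l| < di.
  by rewrite (lt_le_trans (py l))// /d !ge_min lexx.
have pyj l : `|p 0 l - y 0 l| < dj.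
  by rewrite (lt_le_trans (py l))// /d !ge_min lexx orbT.
rewrite -lerBlDl [leRHS]splitr.
have -> : g j p - g i p = (g j p - g j y) + (g j y - g i y) + (g i y - g i p).
  by ring.
rewrite -[X in _ <= X + _]addr0 !lerD//.
- exact: le_trans (ler_norm _) (ltW (Hj y yS pyj)).
- by rewrite subr_le0.
- by rewrite (le_trans (ler_norm _))// distrC ltW// Hi.
Unshelve. all: by end_near. Qed.

(** A form of Ky Fan's inequality.  The relation [conv] says that a filter on
    [P] converges to a point; that every ultrafilter converges is compactness.
    On the mixtures of finitely many points, the equilibrium weights of
    [simplex_equilibrium] are carried by best replies, so no listed point beats
    the mixture against itself.  The conditions for all finite lists generate a
    filter; the limit of an ultrafilter above it satisfies all of them. *)
Lemma compact_convex_equilibrium (R : realType) (P : Type) (p0 : P)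
    (conv : set_system P -> P -> Prop) (g : P -> P -> R) :
  (forall U, UltraFilter U -> exists p, conv U p) ->
  (forall F p, ProperFilter F -> conv F p ->
    g f f @[f --> F] --> g p p /\ forall h, g f h @[f --> F] --> g p h) ->
  (forall n (h : 'I_n.+1 -> P), exists mix : 'rV[R]_n.+1 -> P,
    forall x, simplex x -> conv (mix y @[y --> within simplex (nbhs x)]) (mix x)
      /\ forall f, g f (mix x) = \sum_i x 0 i * g f (h i)) ->
  exists p, forall h, g p h <= g p p.
Proof.
move=> ultra_conv g_conv mixing.
have finite_eq n (h : 'I_n.+1 -> P) : exists p, forall i, g p (h i) <= g p p.
  have [mix mixP] := mixing n h.
  have [|x xS xP] := @simplex_equilibrium R n (fun i x => g (mix x) (h i)).
    move=> i x xS e e0; have [mix_x _] := mixP x xS.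
    have PF : ProperFilter (mix y @[y --> within (@simplex R n.+1) (nbhs x)]).
      apply: fmap_proper_filter; apply: Build_ProperFilter_ex => A.
      by move=> /nbhs_singleton/(_ xS); exists x.
    have [_ /(_ (h i))] := g_conv _ _ PF mix_x.
    move=> /cvgrPdist_lt/(_ e e0) /nbhs_ballP[d /= d0 dP].
    exists d => // y yS xy; apply: dP => //; split=> // a j.
    by rewrite ord1; exact: xy.
  exists (mix x) => j; have [_ ->] := mixP x xS.
  have [xge0 xsum] := xS.
  rewrite -[leLHS]mul1r -xsum mulr_suml; apply: ler_sum => i _.
  have := xge0 i; rewrite le_eqVlt => /predU1P[<-|xi0]; first by rewrite !mul0r.
  by rewrite ler_wpM2l// xP.
pose F : set_system P := [set A | exists s : seq P,
  [set p | forall h, List.In h s -> g p h <= g p p] `<=` A].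
have FF : ProperFilter F.
  apply: Build_ProperFilter_ex => [A [s sA]|].
    have [p pP] := finite_eq (size s) (fun i => nth p0 s i).
    exists p; apply: sA => h /(@List.In_nth _ s h p0)[k [/ssrnat.ltP ks <-]].
    have -> : List.nth k s p0 = nth p0 s k.
      by elim: s k {pP ks} => [|a s IH] [|k] //=.
    by have := pP (Ordinal (leqW ks)).
  split; first by exists [::].
    move=> A B [s sA] [r rB]; exists (s ++ r) => p pP; split.
      by apply: sA => h hs; apply: pP; apply/List.in_or_app; left.
    by apply: rB => h hs; apply: pP; apply/List.in_or_app; right.
  by move=> A B AB [s sA]; exists s; exact: subset_trans sA AB.
have [U [UU FU]] := ultraFilterLemma FF.
have [p Up] := ultra_conv U UU.
have PU : ProperFilter U := @ultra_proper _ _ UU.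
have UF : Filter U by exact: filter_filter.
have [gpp gph] := g_conv U p PU Up.
exists p => h; rewrite -subr_ge0.
have gB := @cvgB _ _ _ U UF _ _ _ _ gpp (gph h).
apply: (@closed_cvg _ _ U PU _ (fun y : R => 0 <= y) (@closed_ge R 0) _ _ gB).
apply: FU; exists [:: h] => q /= qh.
by rewrite subr_ge0; apply: qh; left.
Qed.

(** * Sets of prescribed mass on a sub-sigma-algebra *)

Section mass.
Context {R : realType} {d : measure_display} {T : measurableType d}.
Variable lambda : probability T R.

Definition mass (E : set T) : R := fine (lambda E).

Lemma massE E : measurable E -> lambda E = (mass E)%:E.
Proof. by move=> mE; rewrite /mass fineK// fin_num_measure. Qed.

Lemma mass_ge0 E : 0 <= mass E.
Proof. by rewrite fine_ge0. Qed.

Lemma mass0 : mass set0 = 0.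
Proof. by rewrite /mass measure0. Qed.

Lemma massT : mass setT = 1.
Proof. by rewrite /mass probability_setT. Qed.

Lemma massU A B : measurable A -> measurable B -> A `&` B = set0 ->
  mass (A `|` B) = mass A + mass B.
Proof.
move=> mA mB AB; apply: EFin_inj; rewrite EFinD -!massE//; last exact: measurableU.
by rewrite measureU.
Qed.

Lemma massDI A B : measurable A -> measurable B ->
  mass A = mass (A `&` B) + mass (A `\` B).
Proof.
move=> mA mB; rewrite -massU ?setUIDK//.
- exact: measurableI.
- exact: measurableD.
- by rewrite setDE setIACA setICr setI0.
Qed.

Lemma le_mass A B : measurable A -> measurable B -> A `<=` B -> mass A <= mass B.
Proof. by move=> mA mB AB; rewrite -lee_fin -!massE// le_measure// inE. Qed.

Lemma mass_le1 A : measurable A -> mass A <= 1.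
Proof. by move=> mA; rewrite -massT le_mass. Qed.

Lemma mass_gt0 A : measurable A -> (0 < lambda A)%E = (0 < mass A).
Proof. by move=> mA; rewrite massE// lte_fin. Qed.

Lemma mass_cvg (A : nat -> set T) : (forall n, measurable (A n)) ->
  {homo A : n m / (n <= m)%N >-> n `<=` m} ->
  mass (A n) @[n --> \oo] --> mass (\bigcup_n A n).
Proof.
move=> mA Ahomo; have mU : measurable (\bigcup_n A n) by exact: bigcup_measurable.
apply: fine_cvg; rewrite -massE//; apply: nondecreasing_cvg_mu => //.
by move=> n k nk; apply/subsetPset/Ahomo.
Qed.

(** Enlarge the set step by step, the step [n] gaining all but [n.+1%:R^-1] of
    what is possible; the union of the steps cannot be enlarged further. *)
Lemma exhaustion (P : set T -> Prop) (B0 : set T) :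
  (forall B, P B -> measurable B) ->
  (forall B : nat -> set T, (forall n, P (B n)) ->
    {homo B : n m / (n <= m)%N >-> n `<=` m} -> P (\bigcup_n B n)) ->
  P B0 -> exists2 B, P B & forall C, P C -> B `<=` C -> mass C <= mass B.
Proof.
move=> Pm Pcup P0.
have step (nB : nat * set T) : exists B', P nB.2 -> [/\ P B', nB.2 `<=` B' &
    forall C, P C -> nB.2 `<=` C -> mass C <= mass B' + nB.1.+1%:R^-1].
  case: nB => n B /=; have [PB|] := pselect (P B); last by exists B.
  pose V := [set mass C | C in [set C | P C /\ B `<=` C]].
  have supV : has_sup V.
    split; first by exists (mass B); exists B => //; split.
    by exists 1 => _ [C [PC _] <-]; apply/mass_le1/Pm.
  have n0 : 0 < n.+1%:R^-1 :> R by rewrite invr_gt0 ltr0n.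
  have [_ [B' [PB' BB'] <-] supB'] := sup_adherent n0 supV.
  exists B' => _; split => // C PC BC; rewrite -lerBlDr.
  apply/ltW/(le_lt_trans _ supB'); rewrite lerB//.
  by apply: sup_upper_bound => //; exists C.
have [next nextP] := choice step.
pose B := fix B n := if n is n'.+1 then next (n', B n') else B0.
have PB n : P (B n).
  by elim: n => [//|n IH]; have [PB' _ _] := nextP (n, B n) IH.
have BS n : B n `<=` B n.+1 by have [_ BS _] := nextP (n, B n) (PB n).
have Bhomo : {homo B : n m / (n <= m)%N >-> n `<=` m}.
  by apply: homo_leq => [X|Y X Z|//]; [exact: subset_refl|exact: subset_trans].
exists (\bigcup_n B n); first exact: Pcup.
move=> C PC BC; apply/ler_addgt0Pr => e e0.
have mB n := Pm _ (PB n).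
have [n ne] : exists n, n.+1%:R^-1 < e :> R.
  have /cvgrPdist_lt/(_ e e0)[N _ /(_ N (leqnn N))] := @cvg_harmonic R.
  rewrite /= sub0r normrN ger0_norm ?invr_ge0// => Ne; by exists N.
have [_ _ /(_ C PC)] := nextP (n, B n) (PB n).
move=> /(_ (subset_trans _ BC))/=; rewrite -/(B n.+1) => CB.
rewrite (le_trans (CB _))//; first by exact: bigcup_sup.
rewrite lerD ?(ltW ne)// le_mass//; first exact: bigcup_measurable.
exact: (@bigcup_sup _ _ n.+1).
Qed.

End mass.

Section maharam.
Context {R : realType} {d : measure_display} {T : measurableType d}.
Variables (lambda : probability T R) (sF : subsigma_algebra T).
Local Notation F := (subsigma_sets sF).
Hypothesis NE : nowhere_equivalent lambda F.
Local Notation m := (mass lambda).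

Lemma subsigma0 : F set0. Proof. by have [] := subsigmaP sF. Qed.

Lemma subsigmaC E : F E -> F (~` E).
Proof. by rewrite -setTD; have [_ + _] := subsigmaP sF; apply. Qed.

Lemma subsigmaT : F setT.
Proof. by rewrite -setC0; exact/subsigmaC/subsigma0. Qed.

Lemma subsigma_bigcup (E : nat -> set T) :
  (forall n, F (E n)) -> F (\bigcup_n E n).
Proof. by have [_ _] := subsigmaP sF; apply. Qed.

Lemma subsigmaU E E' : F E -> F E' -> F (E `|` E').
Proof.
move=> FE FE'; rewrite -bigcup2E; apply: subsigma_bigcup => -[|[|n]] //=; exact: subsigma0.
Qed.

Lemma subsigmaI E E' : F E -> F E' -> F (E `&` E').
Proof.
move=> FE FE'; rewrite -[_ `&` _]setCK setCI.
by apply/subsigmaC/subsigmaU; exact/subsigmaC.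
Qed.

Lemma subsigmaD E E' : F E -> F E' -> F (E `\` E').
Proof. by move=> FE FE'; rewrite setDE; apply: subsigmaI => //; exact: subsigmaC. Qed.

Definition additive_on (nu : set T -> R) :=
  forall E E', F E -> F E' -> E `&` E' = set0 -> nu (E `|` E') = nu E + nu E'.

Lemma additive_onDI nu E E' : additive_on nu -> F E -> F E' ->
  nu E = nu (E `&` E') + nu (E `\` E').
Proof.
move=> nuA FE FE'; rewrite -nuA ?setUIDK//.
- exact: subsigmaI.
- exact: subsigmaD.
- by rewrite setDE setIACA setICr setI0.
Qed.

Lemma additive_on_mass D : measurable D -> additive_on (fun E => m (D `&` E)).
Proof.
move=> mD E E' /subsigma_measurable mE /subsigma_measurable mE' EE'; rewrite setIUr massU//.
- exact: measurableI.
- exact: measurableI.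
- by rewrite setIACA EE' setI0.
Qed.

(** Domination by the mass makes an additive function on [F] countably additive,
    hence a charge on the measurable space with sigma-algebra [F]. *)
Lemma Hahn_on (sigma : set T -> R) (C : R) :
  additive_on sigma -> (forall E, F E -> `|sigma E| <= C * m E) ->
  exists2 P, F P & forall E, F E ->
    (E `<=` P -> 0 <= sigma E) /\ (E `&` P = set0 -> sigma E <= 0).
Proof.
move=> sA sC.
have FE : (@measurable _ (g_sigma_algebraType F)) = F.
  by rewrite /measurable /= (sigma_algebra_id (subsigmaP sF)).
have s0 : sigma set0 = 0.
  have := sA _ _ subsigma0 subsigma0 (setI0 _); rewrite setU0 => /eqP.
  by rewrite -subr_eq0 opprD addrA subrr sub0r oppr_eq0 => /eqP.
pose nu (E : set (g_sigma_algebraType F)) : \bar R := (sigma E)%:E.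
have nu0 : nu set0 = 0%E by rewrite /nu s0.
have nufin E : measurable E -> nu E \is a fin_num by [].
have nusigma : semi_sigma_additive nu.
  move=> E mE tE mU; have FEn n : F (E n) by rewrite -FE.
  pose U n := \big[setU/set0]_(i < n) E i.
  have FU_ n : F (U n).
    by rewrite /U; elim/big_ind: _ => //; [exact: subsigma0|exact: subsigmaU].
  have sU n : \sum_(0 <= i < n) sigma (E i) = sigma (U n).
    elim: n => [|n IH]; first by rewrite big_geq// /U big_ord0 s0.
    rewrite big_nat_recr//= IH /U big_ord_recr/= sA//; first exact: FU_.
    by apply: (@trivIset_bigsetUI _ xpredT E) => // i j _ _; exact: tE.
  under eq_fun do rewrite sumEFin sU.
  apply/fine_cvgP; split; first exact: nearW.
  apply/cvgrPdist_le => e e0 /=.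
  have Ucup : \bigcup_n E n = \bigcup_n U n.
    apply/seteqP; split=> [t [n _ Et]|t [n _ Unt]];
      last exact: bigsetU_bigcup Unt.
    by exists n.+1 => //; rewrite /U big_ord_recr; right.
  have Uhomo : {homo U : n k / (n <= k)%N >-> n `<=` k}.
    by move=> n k nk; exact: subset_bigsetU.
  have := @mass_cvg _ _ _ lambda U (fun n => subsigma_measurable (FU_ n)) Uhomo.
  have C0 : 0 < `|C| + 1 by rewrite ltr_wpDl.
  move=> /cvgrPdist_le/(_ (e / (`|C| + 1)) (divr_gt0 e0 C0)).
  apply: filterS => n; rewrite Ucup.
  have FUU : F (\bigcup_n U n) by exact: subsigma_bigcup.
  have nUU : \bigcup_n U n `&` U n = U n.
    by apply/setIidr; exact: bigcup_sup.
  have mass_tail : m (\bigcup_n U n) - m (U n) = m (\bigcup_n U n `\` U n).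
    by rewrite (massDI _ (subsigma_measurable FUU) (subsigma_measurable (FU_ n))) nUU addrC addKr.
  have sigma_tail :
      sigma (\bigcup_n U n) - sigma (U n) = sigma (\bigcup_n U n `\` U n).
    by rewrite (additive_onDI sA FUU (FU_ n)) nUU addrC addKr.
  rewrite mass_tail sigma_tail => small.
  have FDD : F (\bigcup_n U n `\` U n) by exact: subsigmaD.
  apply: (le_trans (sC _ FDD)).
  apply: (@le_trans _ _ ((`|C| + 1) * m (\bigcup_n U n `\` U n))).
    by rewrite ler_wpM2r ?mass_ge0// ler_wpDr// ler_norm.
  rewrite mulrC -ler_pdivlMr//.
  by rewrite (le_trans _ small)// ler_norm.
pose nu_mixin := isCharge.Build _ (g_sigma_algebraType F) R nu
  nu0 nufin nusigma.
pose nuC : charge (g_sigma_algebraType F) R := HB.pack nu nu_mixin.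
have [P [N [[mP Ppos] [mN Nneg] PN PN0]]] := Hahn_decomposition nuC.
exists P; first by rewrite -FE.
move=> E; rewrite -{1}FE => mE; split => [EP|EP].
  by rewrite -lee_fin; exact: Ppos.
rewrite -lee_fin; apply: Nneg => // t Et.
have : (P `|` N) t by rewrite PN.
by case=> // Pt; have : set0 t by rewrite -EP.
Qed.


(** Take [H] inside [D] that differs, by more than a null set, from the trace on
    [D] of every set of [F], and let [P] in [F] be a set where [H] fills at least
    half of [D], off which it fills at most half.  Keep [H] off [P] and the rest
    of [D] on [P].  Were this null, [H] would be almost the trace of [P]. *)
Lemma halving D : measurable D -> 0 < m D ->
  exists B, [/\ measurable B, B `<=` D, 0 < m B &
    forall E, F E -> m (B `&` E) <= 2^-1 * m (D `&` E)].
Proof.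
move=> mD D0; have [|D0' [mD0 D0D D0P]] := NE mD; first by rewrite mass_gt0.
move: D0' mD0 D0D D0P => H mH HD HP.
have [||P FP sP] := @Hahn_on (fun E => m (H `&` E) - 2^-1 * m (D `&` E)) 2.
- move=> E E' FE FE' EE'.
  rewrite (additive_on_mass mH)// (additive_on_mass mD)//; ring.
- move=> E /subsigma_measurable mE; rewrite (le_trans (ler_normB _ _))//.
  rewrite normrM !ger0_norm ?mass_ge0//.
  have HE : m (H `&` E) <= m E by apply: le_mass => //; exact: measurableI.
  have DE : m (D `&` E) <= m E by apply: le_mass => //; exact: measurableI.
  have := mass_ge0 lambda E; lra.
have mP := subsigma_measurable FP.
pose B := (H `\` P) `|` ((D `\` H) `&` P).
have mB : measurable B.
  by apply: measurableU; [|apply: measurableI => //]; exact: measurableD.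
exists B; split=> //.
- by move=> t [[/HD]|[[]]].
- rewrite -mass_gt0//; have := HP (D `&` P); rewrite (_ : H `+` _ = B).
    by apply; exists P.
  apply/seteqP; split => t.
    move=> [[Ht DPt]|[[Dt Pt] Ht]]; [left; split=> // Pt|by right].
    by apply: DPt; split=> //; exact: HD.
  move=> [[Ht Pt]|[[Dt Ht] Pt]]; [left; split=> // -[]//|by right].
- move=> E FE; have mE := subsigma_measurable FE.
  have mEP : measurable (E `&` P) by exact: measurableI.
  have mEDP : measurable (E `\` P) by exact: measurableD.
  have mDH : measurable (D `\` H) by exact: measurableD.
  have -> : B `&` E = (H `&` (E `\` P)) `|` ((D `\` H) `&` (E `&` P)).
    by apply/seteqP; split => t; rewrite /B /=; tauto.
  rewrite massU; [|exact: measurableI|exact: measurableI|]; last first.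
    by apply/seteqP; split => t //= [[_ [_ ?]] [_ []]].
  have neg : m (H `&` (E `\` P)) - 2^-1 * m (D `&` (E `\` P)) <= 0.
    have [_] := sP _ (subsigmaD FE FP); apply.
    by rewrite setDE -setIA setICl setI0.
  have [/(_ (@subIsetr _ _ _)) pos _] := sP _ (subsigmaI FE FP).
  have -> : m ((D `\` H) `&` (E `&` P)) = m (D `&` (E `&` P)) - m (H `&` (E `&` P)).
    rewrite [m (D `&` _)](@massDI _ _ _ lambda _ H)//; last exact: measurableI.
    rewrite (_ : D `&` (E `&` P) `&` H = H `&` (E `&` P)); last first.
      by apply/seteqP; split => t /=; have := HD t; tauto.
    by rewrite addrC addKr !setDE setIAC.
  have := additive_onDI (additive_on_mass mD) FE FP.
  lra.
Qed.

Lemma shrinking k D : measurable D -> 0 < m D ->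
  exists B, [/\ measurable B, B `<=` D, 0 < m B &
    forall E, F E -> m (B `&` E) <= 2^-1 ^+ k * m (D `&` E)].
Proof.
move=> mD D0; elim: k => [|k [B [mB BD B0 BP]]].
  by exists D; split=> // E FE; rewrite expr0 mul1r.
have [C [mC CB C0 CP]] := halving mB B0.
exists C; split=> //; first exact: subset_trans BD.
move=> E FE; rewrite (le_trans (CP E FE))// exprS -mulrA.
by rewrite ler_pM2l ?BP.
Qed.

(** A power [e] of 1/2 below the total of [nu] leaves a set [P] of [F] where [nu]
    is at least [e] times the mass in [D], and of positive mass in [D]: shrink
    [D `&` P] by the factor [e]. *)
Lemma increment D nu : measurable D -> additive_on nu ->
  (forall E, F E -> 0 <= nu E <= m (D `&` E)) -> 0 < nu setT ->
  exists B, [/\ measurable B, B `<=` D, 0 < m B &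
    forall E, F E -> m (B `&` E) <= nu E].
Proof.
move=> mD nuA nuD nuT.
have [k kP] : exists k, 2^-1 ^+ k < nu setT.
  have /cvgrPdist_lt/(_ _ nuT)[k _ /(_ k (leqnn k))] :=
    @cvg_expr R 2^-1 ltac:(by rewrite ger0_norm// invf_lt1// ltr1n).
  by rewrite /= sub0r normrN ger0_norm// => kP; exists k.
set e := 2^-1 ^+ k in kP; have e0 : 0 <= e by rewrite exprn_ge0.
have [||P FP sP] := @Hahn_on (fun E => nu E - e * m (D `&` E)) (1 + e).
- by move=> E E' FE FE' EE'; rewrite nuA// (additive_on_mass mD)//; ring.
- move=> E FE; have mE := subsigma_measurable FE; rewrite (le_trans (ler_normB _ _))//.
  have /andP[n0 nD] := nuD E FE.
  have DE : m (D `&` E) <= m E by apply: le_mass => //; exact: measurableI.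
  rewrite normrM !ger0_norm ?mass_ge0// mulrDl mul1r lerD//.
    exact: le_trans nD DE.
  by rewrite ler_wpM2l.
have mP := subsigma_measurable FP; have mDP : measurable (D `&` P) by exact: measurableI.
have DP0 : 0 < m (D `&` P).
  have /andP[_ /(lt_le_trans _)] := nuD P FP; apply.
  have [_] := sP _ (subsigmaD subsigmaT FP); rewrite setTD setICl => /(_ erefl) neg.
  have := additive_onDI nuA subsigmaT FP.
  have := additive_onDI (additive_on_mass mD) subsigmaT FP.
  rewrite setTI setTD setIT => DT nT.
  have mDle := mass_le1 lambda mD.
  have eD : e * m D <= e by rewrite ler_piMr.
  have DP' := mass_ge0 lambda (D `&` P).
  have : 0 <= e * m (D `&` P) by rewrite mulr_ge0.
  rewrite DT mulrDr in eD; lra.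
have [B [mB BDP B0 BP]] := shrinking k mDP DP0.
exists B; split=> //; first by apply: subset_trans BDP _; exact: subIsetl.
move=> E FE; have FEP := subsigmaI FE FP.
have [/(_ (@subIsetr _ _ _)) pos _] := sP _ FEP.
have := BP E FE; rewrite -/e -setIA [P `&` E]setIC.
have := additive_onDI nuA FE FP; have /andP[+ _] := nuD _ (subsigmaD FE FP).
lra.
Qed.

(** A maximal [B] with mass at most [nu] has mass [nu]: otherwise [increment],
    applied to the deficit inside [D] minus [B], would enlarge it. *)
Theorem maharam D nu : measurable D -> additive_on nu ->
  (forall E, F E -> 0 <= nu E <= m (D `&` E)) ->
  exists B, [/\ measurable B, B `<=` D & forall E, F E -> m (B `&` E) = nu E].
Proof.
move=> mD nuA nuD.
pose P B := [/\ measurable B, B `<=` D & forall E, F E -> m (B `&` E) <= nu E].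
have [|||B [mB BD Bnu] Bmax] := @exhaustion _ _ _ lambda P set0.
- by move=> B [].
- move=> B BP Bhomo; split.
  + by apply: bigcup_measurable => n _; have [] := BP n.
  + by apply: bigcup_sub => n _; have [] := BP n.
  + move=> E FE; have mE := subsigma_measurable FE; rewrite setI_bigcupl.
    have mBE n : measurable (B n `&` E).
      by have [mB _ _] := BP n; exact: measurableI.
    have Bh : {homo (fun n => B n `&` E) : n k / (n <= k)%N >-> n `<=` k}.
      by move=> n k nk; apply: setSI; exact: Bhomo.
    have mass_lim := @mass_cvg _ _ _ lambda _ mBE Bh.
    apply: (closed_cvg (fun y : R => y <= nu E) (@closed_le R (nu E)) _ _
      mass_lim).
    by apply: nearW => n; have [_ _] := BP n; apply.
- by split=> // E FE; rewrite set0I mass0; have /andP[] := nuD E FE.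
exists B; split=> // E FE; apply/eqP; rewrite eq_le Bnu//= leNgt; apply/negP => lt.
pose rest E := nu E - m (B `&` E).
have restA : additive_on rest.
  move=> E1 E2 F1 F2 E12; rewrite /rest nuA// (additive_on_mass mB)//; ring.
have mDB : measurable (D `\` B) by exact: measurableD.
have restP E1 : F E1 -> 0 <= rest E1 <= m ((D `\` B) `&` E1).
  move=> F1; have mE1 := subsigma_measurable F1; rewrite /rest subr_ge0 Bnu//= lerBlDl.
  have -> : B `&` E1 = D `&` E1 `&` B.
    by apply/seteqP; split => t /=; have := BD t; tauto.
  have -> : (D `\` B) `&` E1 = D `&` E1 `\` B by rewrite !setDE setIAC.
  rewrite -massDI//; last exact: measurableI.
  by have /andP[] := nuD E1 F1.
have restT : 0 < rest setT.
  rewrite (additive_onDI restA subsigmaT FE) setTI ltr_wpDr//.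
    by have /andP[] := restP _ (subsigmaD subsigmaT FE).
  by rewrite /rest subr_gt0.
have [C [mC CD C0 CP]] := increment mDB restA restP restT.
have BC : B `&` C = set0.
  by apply/seteqP; split => t // [Bt /CD[_]].
have : m (B `|` C) <= m B.
  apply: Bmax; last exact: subsetUl.
  split; first exact: measurableU.
    by move=> t [/BD//|/CD[]].
  move=> E1 F1; have mE1 := subsigma_measurable F1; rewrite setIUl massU; last 1 first.
  - by rewrite setIACA BC set0I.
  - by have := CP E1 F1; rewrite /rest lerBrDl.
  - exact: measurableI.
  - exact: measurableI.
by rewrite massU// leNgt ltrDl C0.
Qed.

End maharam.

(** * Strategies as binary trees of sets *)

(** Strategies take values in binary words rather than in actions because a
    prescribed distribution over words can be realised letter by letter, each
    letter splitting sets of agents in two.  A surjection of the Cantor space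
    onto the action space turns words into actions. *)
Record strategy d (T : measurableType d) := Strategy {
  path_of :> T -> nat -> bool;
  measurable_path : forall n, measurable [set t | path_of t n] }.

Definition cylinder d (T : measurableType d) (f : T -> nat -> bool)
  (w : seq bool) : set T := [set t | mkseq (f t) (size w) = w].

Section cylinders.
Context {d : measure_display} {T : measurableType d}.
Implicit Type f : T -> nat -> bool.

Lemma cylinder_nil f : cylinder f [::] = setT.
Proof. by apply/seteqP; split. Qed.

Lemma cylinder_rcons f w b :
  cylinder f (rcons w b) = cylinder f w `&` [set t | f t (size w) = b].
Proof.
apply/seteqP; split=> t; rewrite /cylinder /= size_rcons mkseqS.
  by move=> /eqP; rewrite eqseq_rcons => /andP[/eqP -> /eqP ->].
by move=> [-> ->].
Qed.

Lemma measurable_cylinder (f : strategy T) w : measurable (cylinder f w).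
Proof.
elim/last_ind: w => [|w b IH]; first by rewrite cylinder_nil.
rewrite cylinder_rcons; apply: measurableI => //.
case: b; first exact: measurable_path.
rewrite (_ : mkset _ = ~` [set t | f t (size w)]).
  by apply: measurableC; exact: measurable_path.
by apply/seteqP; split => t /=; case: (f t _).
Qed.

End cylinders.

Section strategies.
Context {R : realType} {d : measure_display} {T : measurableType d}.
Variables (lambda : probability T R) (sF : subsigma_algebra T).
Local Notation F := (subsigma_sets sF).
Hypothesis NE : nowhere_equivalent lambda F.
Local Notation m := (mass lambda).

Definition weight (f : strategy T) w E := m (cylinder f w `&` E).

Lemma weight_bounds (f : strategy T) w E : measurable E ->
  0 <= weight f w E <= 1.
Proof.
move=> mE; rewrite mass_ge0 mass_le1//.
by apply: measurableI => //; exact: measurable_cylinder.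
Qed.

Lemma weight_nil (f : strategy T) E : weight f [::] E = m E.
Proof. by rewrite /weight cylinder_nil setTI. Qed.

Lemma weight_split (f : strategy T) w E : measurable E ->
  weight f w E = weight f (rcons w false) E + weight f (rcons w true) E.
Proof.
move=> mE; have mc w' : measurable (cylinder f w' `&` E).
  by apply: measurableI => //; exact: measurable_cylinder.
rewrite /weight -massU//; last first.
  by rewrite !cylinder_rcons; apply/seteqP; split => t //= [[[_ ->]] _ [[_]]].
congr m; rewrite -setIUl; congr (_ `&` _); rewrite !cylinder_rcons -setIUr.
by apply/esym/setIidl => t _ /=; case: (f t _); [right|left].
Qed.

Lemma additive_on_weight (f : strategy T) w : additive_on sF (weight f w).
Proof. exact/additive_on_mass/measurable_cylinder. Qed.

Section realization.
Variable mu : seq bool -> set T -> R.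
Hypotheses (mu_nil : forall E, F E -> mu [::] E = m E)
  (mu_split : forall w E, F E ->
    mu w E = mu (rcons w false) E + mu (rcons w true) E)
  (mu_additive : forall w, additive_on sF (mu w))
  (mu_ge0 : forall w E, F E -> 0 <= mu w E).

Let represents w B := measurable B /\ forall E, F E -> m (B `&` E) = mu w E.

Let split_ex (wB : seq bool * set T) : exists B, represents wB.1 wB.2 ->
  B `<=` wB.2 /\ represents (rcons wB.1 true) B.
Proof.
case: wB => w B /=; have [[mB Bmu]|] := pselect (represents w B); last first.
  by move=> nr; exists B.
have [|B' [mB' B'B B'mu]] := maharam NE mB (@mu_additive (rcons w true)).
  by move=> E FE; rewrite mu_ge0//= Bmu// (mu_split w)// lerDr mu_ge0.
by exists B'.
Qed.

Let cut := projT1 (choice split_ex).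

Let cutP w B : represents w B ->
  cut (w, B) `<=` B /\ represents (rcons w true) (cut (w, B)).
Proof. exact: (projT2 (choice split_ex) (w, B)). Qed.

(* lists are read backwards, the last letter of the word coming first *)
Let region := fix region (r : seq bool) : set T :=
  if r is b :: r' then
    let C := cut (rev r', region r') in if b then C else region r' `\` C
  else setT.

Let prefix (t : T) := fix prefix n : seq bool :=
  if n is n'.+1 then
    `[< cut (rev (prefix n'), region (prefix n')) t >] :: prefix n'
  else [::].

Let path (t : T) n : bool := head false (prefix t n.+1).

Let mkseq_path t n : mkseq (path t) n = rev (prefix t n).
Proof. by elim: n => //= n IH; rewrite mkseqS IH rev_cons. Qed.

Let region_represents r : represents (rev r) (region r).
Proof.
elim: r => [|b r IH].
  by split=> [|E FE] /=; [exact: measurableT|rewrite setTI mu_nil].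
have [CR [mC Cmu]] := cutP IH; have [mR Rmu] := IH.
rewrite rev_cons; case: b => //=; split=> [|E FE]; first exact: measurableD.
have mE := subsigma_measurable FE.
have := mu_split (rev r) FE.
rewrite -Rmu// -Cmu// [m (region r `&` E)](@massDI _ _ _ lambda _
  (cut (rev r, region r)))//; last exact: measurableI.
rewrite (_ : _ `&` _ `&` _ = cut (rev r, region r) `&` E); last first.
  by apply/seteqP; split => t /=; have := CR t; tauto.
by rewrite addrC => /addIr <-; congr m; rewrite !setDE setIAC.
Qed.

Let cylinder_path w : cylinder path w = region (rev w).
Proof.
elim/last_ind: w => [|w b IH]; first by rewrite cylinder_nil.
rewrite cylinder_rcons IH rev_rcons /=.
have [CR _] := cutP (region_represents (rev w)).
have pathE t : region (rev w) t ->
    path t (size w) = `[< cut (rev (rev w), region (rev w)) t >].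
  move=> Rt; have wt : mkseq (path t) (size w) = w by move: Rt; rewrite -IH.
  have pw : prefix t (size w) = rev w by rewrite -[LHS]revK -mkseq_path wt.
  by rewrite /path /= pw.
apply/seteqP; split=> t.
  by move=> [Rt] /=; rewrite pathE// => <-; case: asboolP.
case: b => /= [Ct|[Rt Ct]].
  by split; [exact: CR|rewrite pathE; [exact/asboolP|exact: CR]].
by split=> //; rewrite pathE//; exact/asboolP.
Qed.

(** Starting from the whole space, [maharam] cuts the set of agents that follow
    [w] into those that go on with 1 and with 0, with the prescribed weights. *)
Lemma realization : exists f : strategy T,
  forall w E, F E -> weight f w E = mu w E.
Proof.
have mpath n : measurable [set t | path t n].
  rewrite (_ : mkset _ = \bigcup_(w : n.-tuple bool)
      cylinder path (rcons w true)); last first.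
    apply/seteqP; split=> t /=.
      move=> tn; have sz : size (mkseq (path t) n) == n by rewrite size_mkseq.
      exists (Tuple sz) => //=.
      by rewrite cylinder_rcons /cylinder /= size_mkseq.
    by move=> [w _]; rewrite cylinder_rcons size_tuple => -[].
  apply: countable_bigcupT_measurable => // w.
  by rewrite cylinder_path; have [] := region_represents (rev (rcons w true)).
exists (Strategy mpath) => w E FE; rewrite /weight /= cylinder_path.
by have [_ ->//] := region_represents (rev w); rewrite revK.
Qed.

End realization.

Definition converges (U : set_system (strategy T)) (f : strategy T) :=
  forall w E, F E -> weight h w E @[h --> U] --> weight f w E.

Lemma ultra_bounded_cvg (P : Type) (U : set_system P) (phi : P -> R) :
  UltraFilter U -> (forall p, 0 <= phi p <= 1) ->
  exists l : R, phi p @[p --> U] --> l.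
Proof.
move=> UU phi01; have PU : ProperFilter U := @ultra_proper _ _ UU.
have [|l [_ clu]] := @segment_compact R 0 1 (phi p @[p --> U]) _.
  apply: (@filterS _ U _ setT _ _ filterT) => p _ /=.
  by rewrite in_itv/=; exact: phi01.
exists l => A Al; have [//|UA] := in_ultra_setVsetC (phi @^-1` A) UU.
by have [x [nAx Ax]] := clu (~` A) A UA Al.
Qed.

(** Compactness of the set of strategies: limits of weights inherit the identities
    that [realization] requires. *)
Lemma ultra_converges (U : set_system (strategy T)) :
  UltraFilter U -> exists f, converges U f.
Proof.
move=> UU; have PU : ProperFilter U := @ultra_proper _ _ UU.
have UF : Filter U by exact: filter_filter.
have lim_ex (wE : seq bool * set T) : exists l : R,
    F wE.2 -> weight h wE.1 wE.2 @[h --> U] --> l.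
  case: wE => w E /=; have [FE|nFE] := pselect (F E); last by exists 0.
  have [|l lP] := @ultra_bounded_cvg _ U (fun h => weight h w E) UU.
    by move=> h; apply: weight_bounds; exact: subsigma_measurable FE.
  by exists l.
have [L LP] := choice lim_ex.
have {}LP w E (FE : F E) : weight h w E @[h --> U] --> L (w, E) := LP (w, E) FE.
have Lunique w E l : F E -> weight h w E @[h --> U] --> l -> L (w, E) = l.
  by move=> FE; exact: cvg_unique (LP w E FE).
have [||||f fL] := @realization (fun w E => L (w, E)).
- move=> E FE; apply: Lunique => //.
  under eq_fun do rewrite weight_nil; exact: cvg_cst.
- move=> w E FE; apply: Lunique => //.
  under eq_fun do rewrite (weight_split _ _ (subsigma_measurable FE)).
  by apply: cvgD; exact: LP.
- move=> w E E' FE FE' EE'; apply: Lunique; first exact: subsigmaU.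
  under eq_fun do rewrite (additive_on_weight _ _ FE FE' EE').
  by apply: cvgD; exact: LP.
- move=> w E FE; apply: (closed_cvg (fun y : R => 0 <= y) (@closed_ge R 0) _ _
    (LP w E FE)).
  by apply: filterE => h; exact: mass_ge0.
by exists f => w E FE; rewrite fL//; exact: LP.
Qed.

Definition mixture n (x : 'rV[R]_n) (h : 'I_n -> strategy T) (f : strategy T) :=
  forall w E, F E -> weight f w E = \sum_i x 0 i * weight (h i) w E.

Lemma mixture_exists n (x : 'rV[R]_n) (h : 'I_n -> strategy T) :
  simplex x -> exists f, mixture x h f.
Proof.
move=> [x0 x1].
apply: (@realization (fun w E => \sum_i x 0 i * weight (h i) w E)).
- move=> E FE; under eq_bigr do rewrite weight_nil.
  by rewrite -mulr_suml x1 mul1r.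
- move=> w E FE; rewrite -big_split; apply: eq_bigr => i _ /=.
  by rewrite -mulrDr -weight_split//; exact: subsigma_measurable FE.
- move=> w E E' FE FE' EE'; rewrite -big_split; apply: eq_bigr => i _ /=.
  by rewrite -mulrDr additive_on_weight.
- by move=> w E FE; apply: sumr_ge0 => i _; rewrite mulr_ge0// mass_ge0.
Qed.

Lemma continuous_mixture n (h : 'I_n -> strategy T) (mix : 'rV[R]_n -> strategy T) x :
  (forall y, simplex y -> mixture y h (mix y)) -> simplex x ->
  converges (mix y @[y --> within simplex (nbhs x)]) (mix x).
Proof.
move=> mixP xS w E FE.
have sumC : \sum_i y 0 i * weight (h i) w E @[y --> x] --> weight (mix x) w E.
  rewrite mixP//; apply: (@cvg_big _ _ _ _ _ _ _ (nbhs x)) => [|i _].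
    exact: add_continuous.
  by apply: cvgMr_tmp; exact: coord_continuous.
move=> A /sumC; rewrite /= !nbhs_simpl /within /=.
by apply: filterS => y Ay yS; rewrite mixP.
Qed.

(** The notion quantifies over all strategies with given weights, so such a
    functional depends on the weights only. *)
Definition affine_continuous (Psi : strategy T -> R) :=
  (forall U f, Filter U -> converges U f -> Psi h @[h --> U] --> Psi f) /\
  (forall n (x : 'rV[R]_n) h f, simplex x -> mixture x h f ->
    Psi f = \sum_i x 0 i * Psi (h i)).

Lemma affine_continuous_weight w E : F E ->
  affine_continuous (fun f => weight f w E).
Proof. by move=> FE; split=> [U f UF|n x h f xS]; apply. Qed.

Lemma affine_continuous_sum (I : Type) (r : seq I) (c : I -> R)
    (Psi : I -> strategy T -> R) : (forall i, affine_continuous (Psi i)) ->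
  affine_continuous (fun f => \sum_(i <- r) c i * Psi i f).
Proof.
move=> PsiP; split=> [U f UF Uf|n x h f xS hf].
  apply: (@cvg_big _ _ _ _ _ _ _ U) => [|i _]; first exact: add_continuous.
  by apply: cvgMl_tmp; exact: (PsiP i).1.
under [RHS]eq_bigr do rewrite mulr_sumr.
rewrite exchange_big; apply: eq_bigr => i _ /=.
rewrite ((PsiP i).2 _ _ _ _ xS hf) mulr_sumr.
by apply: eq_bigr => j _; rewrite mulrCA.
Qed.

Lemma affine_continuous_lim (Psi : strategy T -> R) :
  (forall e : R, 0 < e -> exists2 Phi, affine_continuous Phi &
    forall f, `|Psi f - Phi f| <= e) -> affine_continuous Psi.
Proof.
move=> approx; split=> [U f UF Uf|n x h f xS hf].
  apply/cvgrPdist_le => e e0; have e3 : 0 < e / 3 by rewrite divr_gt0.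
  have [Phi [PhiC _] PhiP] := approx _ e3.
  have /cvgrPdist_le/(_ _ e3) := PhiC U f UF Uf.
  apply: filterS => h hf; have := PhiP f; have := PhiP h.
  by rewrite !ler_norml in hf * => /andP[? ?] /andP[? ?]; lra.
apply/eqP; rewrite -subr_eq0 -normr_le0; apply/ler_addgt0Pr => e e0.
rewrite add0r; have e2 : 0 < e / 2 by rewrite divr_gt0.
have [Phi [_ PhiA] PhiP] := approx _ e2.
have [x0 x1] := xS.
have -> : Psi f - \sum_i x 0 i * Psi (h i) =
    (Psi f - Phi f) + \sum_i x 0 i * (Phi (h i) - Psi (h i)).
  under [in RHS]eq_bigr do rewrite mulrBr.
  by rewrite sumrB -(PhiA _ _ _ _ xS hf) addrA subrK.
rewrite [leRHS]splitr (le_trans (ler_normD _ _))// lerD//.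
rewrite (le_trans (ler_norm_sum _ _ _))//.
move: (e / 2) PhiP {e2} => e2 PhiP.
rewrite -[leRHS]mul1r -x1 mulr_suml; apply: ler_sum => i _.
by rewrite normrM (ger0_norm (x0 i)) ler_wpM2l// distrC.
Qed.

End strategies.

(** * The Cantor space *)

Definition agree n (x y : nat -> bool) := forall i, (i < n)%N -> x i = y i.

Definition pad (w : seq bool) : nat -> bool := nth false w.

Lemma agree_le n k x y : (n <= k)%N -> agree k x y -> agree n x y.
Proof. by move=> nk xy i ni; apply: xy; exact: leq_trans nk. Qed.

Lemma agree_pad x n : agree n x (pad (mkseq x n)).
Proof. by move=> i ni; rewrite /pad nth_mkseq. Qed.

Lemma agree_mkseq n x y : agree n x y <-> mkseq x n = mkseq y n.
Proof.
split=> [xy|xy i ni].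
  by apply/eq_in_map => i; rewrite mem_iota => /andP[_ ni]; exact: xy.
by have /(congr1 (fun s => nth false s i)) := xy; rewrite !nth_mkseq.
Qed.

Lemma nbhs_agree n (x : cantor_space) : \forall y \near x, agree n x y.
Proof.
elim: n => [|n IH]; first by apply: filterE.
have xn : \forall y \near x, y n = x n.
  have : nbhs (x n) [set x n].
    by apply: open_nbhs_nbhs; split=> //; exact: discrete_open.
  exact: (@proj_continuous nat (fun=> bool) n x).
apply: filterS2 IH xn => y IH yn i; rewrite ltnS leq_eqVlt => /predU1P[->//|].
exact: IH.
Qed.

(** Otherwise words outside [B] that agree with [x] longer and longer would
    converge to [x]. *)
Lemma nbhs_cantor (x : cantor_space) (B : set cantor_space) : nbhs x B ->
  exists n, forall y, agree n x y -> B y.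
Proof.
move=> xB; apply: contrapT => /forallNP noB.
have /choice[y yP] n : exists y : cantor_space, agree n x y /\ ~ B y.
  by have /existsNP[y /not_implyP[xy By]] := noB n; exists y.
have : y n @[n --> \oo] --> x.
  apply/cvg_sup => i A [_ [[C Cop <-] Cx] CA].
  exists i.+1 => // n /= ni; apply: CA => /=.
  by rewrite /proj -((yP n).1 i ni).
by move=> /(_ B xB)[n _ /(_ n (leqnn n))]; exact: (yP n).2.
Qed.

Lemma uniform_agree (R : realType) (psi : cantor_space -> R) (e : R) :
  continuous psi -> 0 < e ->
  exists n, forall x y, agree n x y -> `|psi x - psi y| <= e.
Proof.
move=> psiC e0.
have /compact_near_coveringP/(_ nat \oo
    (fun n x => forall y, agree n x y -> `|psi x - psi y| <= e) _) :=
  cantor_space_compact.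
case=> [x _|n _ nP]; last by exists n => x; exact: (nP n (leqnn n) x I).
have e2 : 0 < e / 2 by rewrite divr_gt0.
have /cvgrPdist_le/(_ _ e2)/nbhs_cantor[n nP] := psiC x.
exists ([set y | agree n x y], [set k | (n <= k)%N]).
  by split; [exact: nbhs_agree|exists n].
move=> [x' k] /= [xx' nk] y x'y.
have xy : agree n x y.
  by move=> i ni; rewrite (xx' i ni); exact: (agree_le nk x'y).
rewrite [leRHS]splitr (le_trans (ler_distD (psi x) _ _))// lerD ?nP//.
by rewrite distrC nP.
Qed.

(** * Expectations of bounded functions *)

Section expectation.
Context {R : realType} {d : measure_display} {T : measurableType d}.
Variable lambda : probability T R.
Local Notation m := (mass lambda).

Definition expect (g : T -> R) : R := \int[lambda]_t g t.

Lemma bounded_integrable (g : T -> R) (C : R) : measurable_fun setT g ->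
  (forall t, `|g t| <= C) -> lambda.-integrable setT (EFin \o g).
Proof.
move=> mg gC; apply: measurable_bounded_integrable => //.
  by rewrite (le_lt_trans (probability_le1 _ _))// ltry.
exists C; split; first exact: num_real.
by move=> x Cx t _; exact: le_trans (gC t) (ltW Cx).
Qed.

Lemma expect_cst (c : R) : expect (fun=> c) = c.
Proof. by rewrite /expect Rintegral_cst// -/(mass lambda setT) massT mulr1. Qed.

Lemma expect_indic (E : set T) : measurable E -> expect \1_E = m E.
Proof.
move=> mE; rewrite /expect /Rintegral /mass; congr fine.
by rewrite integral_indic// setIT.
Qed.

Lemma integrable_sum (I : Type) (r : seq I) (c : I -> R) (B : I -> set T) :
  (forall i, measurable (B i)) ->
  lambda.-integrable setT (EFin \o (fun t => \sum_(i <- r) c i * \1_(B i) t)).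
Proof.
move=> mB; elim: r => [|j r IH].
  by apply: eq_integrable (integrable0 _ _) => // t _; rewrite /= big_nil.
have ij := integrableZl measurableT (c j) (integrable_indic lambda (mB j)).
apply: eq_integrable (integrableD measurableT ij IH) => // t _.
by rewrite /= big_cons EFinD EFinM.
Qed.

Lemma expect_sum (I : Type) (r : seq I) (c : I -> R) (B : I -> set T) :
  (forall i, measurable (B i)) ->
  expect (fun t => \sum_(i <- r) c i * \1_(B i) t) = \sum_(i <- r) c i * m (B i).
Proof.
move=> mB; elim: r => [|i r IH].
  under [in LHS]eq_fun do rewrite big_nil; by rewrite big_nil expect_cst.
rewrite big_cons -IH -expect_indic// /expect -RintegralZl//; last first.
  exact: integrable_indic.
rewrite -RintegralD//; last exact: integrable_sum.
  by apply: eq_Rintegral => t _; rewrite big_cons.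
by have := integrable_sum [:: i] c mB; under eq_fun do rewrite big_seq1.
Qed.

(** Closeness off a set of small mass suffices, as long as the difference is
    bounded; the right-hand side is the integral of a two-step function. *)
Lemma expect_dist (g h : T -> R) (E : set T) (e K : R) :
  lambda.-integrable setT (EFin \o g) -> lambda.-integrable setT (EFin \o h) ->
  measurable E -> 0 <= e -> 0 <= K ->
  (forall t, E t -> `|g t - h t| <= e) -> (forall t, `|g t - h t| <= K) ->
  `|expect g - expect h| <= e + K * m (~` E).
Proof.
move=> ig ih mE e0 K0 ghe ghK; rewrite /expect -RintegralB//.
have igh : lambda.-integrable setT (EFin \o (fun t => g t - h t)).
  by apply: eq_integrable (integrableB measurableT ig ih).
rewrite (le_trans (le_normr_Rintegral _ _))//.
have mEC : measurable (~` E) by exact: measurableC.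
pose b t : R := \sum_(i <- [:: false; true])
  (if i then K else e) * \1_(if i then ~` E else setT) t.
have <- : expect b = e + K * m (~` E).
  rewrite /b expect_sum; last by case.
  by rewrite big_cons big_seq1 massT mulr1.
apply: le_Rintegral => //.
- by apply: eq_integrable (integrable_norm igh).
- by apply: integrable_sum => -[].
- move=> t _; rewrite /b big_cons big_seq1 /= indicT mulr1 indicE.
  have [tE|tE] := pselect (E t).
    by rewrite (le_trans (ghe t tE))// lerDl mulr_ge0.
  by rewrite mem_set// mulr1 (le_trans (ghK t))// lerDr.
Qed.

End expectation.

(** * Functions measurable in one variable and continuous in the other *)

Lemma measurable_fun_superlevel {R : realType} {d : measure_display}
    {S : measurableType d} (h : S -> R) :
  (forall r, measurable [set s | r <= h s]) -> measurable_fun setT h.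
Proof.
move=> mh; apply: (measurability _ (RGenCInfty.measurableE R)).
move=> _ [_ [r ->] <-]; rewrite setTI (_ : _ @^-1` _ = [set s | r <= h s])//.
by apply/seteqP; split => s /=; rewrite in_itv/= andbT.
Qed.

Section parametrized_actions.
Context {R : realType} {A : pmetricType R} (pi : cantor_space -> A).
Hypotheses (piC : continuous pi) (piS : forall a, exists x, pi x = a).

Definition atom (w : seq bool) : A := pi (pad w).

Lemma dense_atom (a : A) (B : set A) : nbhs a B -> exists w, B (atom w).
Proof.
have [x <-] := piS a; move=> /piC/nbhs_cantor[n nB].
by exists (mkseq x n); apply: nB; exact: agree_pad.
Qed.

(** The set where [phi] exceeds [r] is a countable union of rectangles: near [a],
    exceeding [r] by a margin is a condition on the countably many atoms of a
    small cell around [a]. *)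
Lemma measurable_caratheodory {d : measure_display} {S : measurableType d}
    (phi : S * A -> R) :
  (forall a r, measurable [set s | r <= phi (s, a)]) ->
  (forall s, continuous (fun a => phi (s, a))) ->
  measurable_fun setT (phi : S * borel A -> R).
Proof.
move=> mphi phiC.
pose cell (k : nat) (w : seq bool) : set A := (ball (atom w) k.+1%:R^-1)°.
pose good (r : R) k w (j : nat) : set S :=
  ~` \bigcup_(v : seq bool) (if `[< cell k w (atom v) >]
     then ~` [set s | r + j.+1%:R^-1 <= phi (s, atom v)] else set0).
have mgood r k w j : measurable (good r k w j).
  apply/measurableC/countable_bigcupT_measurable => // v.
  by case: ifP => // _; exact/measurableC/mphi.
have goodP r k w j s : good r k w j s <->
    forall v, cell k w (atom v) -> r + j.+1%:R^-1 <= phi (s, atom v).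
  split=> [gs v cv|gs [v _]]; last by case: asboolP => // /gs ? /(_ _).
  by apply: contrapT => ns; apply: gs; exists v => //; rewrite asboolT.
have superlevel r : [set sa | r < phi sa] =
    \bigcup_(i : nat * seq bool * nat)
      (good r i.1.1 i.1.2 i.2 `*` cell i.1.1 i.1.2).
  apply/seteqP; split=> [[s a] /= rsa|[s a] [[[k w] j] _ [/= /goodP gs ca]]].
    have e0 : 0 < (phi (s, a) - r) / 2 by rewrite divr_gt0// subr_gt0.
    have inv_lt e : 0 < e :> R -> exists n : nat, n.+1%:R^-1 < e.
      move=> {}e0; have /cvgrPdist_lt/(_ e e0)[N _ /(_ N (leqnn N))] :=
        @cvg_harmonic R.
      by rewrite /= sub0r normrN ger0_norm ?invr_ge0// => Ne; exists N.
    have [j je] := inv_lt _ e0.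
    have /cvgrPdist_lt/(_ _ e0)/nbhs_ballP[e /= {}e0' eP] := phiC s a.
    have [k ke] := inv_lt _ (divr_gt0 e0' (ltr0n R 2)).
    have k0 : 0 < k.+1%:R^-1 / 2 :> R by rewrite divr_gt0// invr_gt0 ltr0n.
    have [w wP] := dense_atom (nbhsx_ballx a _ k0).
    exists (k, w, j) => //=; split=> /=.
      apply/goodP => v cv; have := interior_subset cv.
      move=> wv; have := eP (atom v).
      have av : ball a e (atom v).
        apply: le_ball (ball_triangle wP wv); move: ke k0.
        by move: (k.+1%:R^-1) => q; lra.
      move=> /(_ av); rewrite ltr_norml => /andP[_]; move: je.
      by move: (j.+1%:R^-1) => q; lra.
    rewrite /cell /interior; apply: filterS (nbhsx_ballx a _ k0) => b ab.
    by have := ball_triangle (ball_sym wP) ab; rewrite -splitr.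
  rewrite /= ltNge; apply/negP => le_r.
  have j0 : 0 < j.+1%:R^-1 :> R by rewrite invr_gt0 ltr0n.
  have near_lt : \forall b \near a, phi (s, b) < r + j.+1%:R^-1.
    apply: cvgr_lt (phiC s a) _ _; move: j0 le_r.
    by move: (j.+1%:R^-1) => q; lra.
  have [|v [cv]] := @dense_atom a
      (cell k w `&` [set b | phi (s, b) < r + j.+1%:R^-1]).
    apply: filterI => //; apply: open_nbhs_nbhs; split=> //.
    exact: open_interior.
  by rewrite /= ltNge gs.
apply: (measurability _ (RGenOInfty.measurableE R)).
move=> _ [_ [r ->] <-]; rewrite setTI (_ : _ @^-1` _ = [set sa | r < phi sa]).
  rewrite superlevel; apply: countable_bigcupT_measurable => // i.
  apply: measurableX => //; apply: sub_sigma_algebra; exact: open_interior.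
by apply/seteqP; split => s /=; rewrite in_itv/= andbT.
Qed.

Definition played {d : measure_display} {T : measurableType d}
  (f : strategy T) (t : T) : borel A := pi (f t).

(** By continuity of [pi], whether the action lies in an open set is decided by a
    finite prefix of the word. *)
Lemma measurable_played {d : measure_display} {T : measurableType d}
  (f : strategy T) : measurable_fun setT (played f).
Proof.
apply: (@measurability _ _ _ (borel A) setT (played f) (@open A)) => // _ [B Bop <-]; rewrite setTI.
rewrite (_ : _ @^-1` _ = \bigcup_(w : seq bool)
    (if `[< forall x, agree (size w) x (pad w) -> B (pi x) >]
     then cylinder f w else set0)); last first.
  apply/seteqP; split=> [t Bt|t [w _]]; last first.
    case: asboolP => // wB tw; apply: wB; apply/agree_mkseq.
    rewrite tw; apply: (@eq_from_nth _ false); first by rewrite size_mkseq.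
    by move=> i iw; rewrite nth_mkseq.
  have /piC/nbhs_cantor[n nB] : nbhs (pi (f t)) B by exact: open_nbhs_nbhs.
  exists (mkseq (f t) n) => //; rewrite asboolT; last first.
    move=> x; rewrite size_mkseq => xt; apply: nB => i ni.
    by rewrite (xt i ni) -agree_pad.
  by rewrite /cylinder /= size_mkseq.
apply: countable_bigcupT_measurable => // w.
by case: ifP => // _; exact: measurable_cylinder.
Qed.

End parametrized_actions.

(** * Payoff integrals as limits of weights *)

(** The sum counts the steps below [z]; it is the integer part of [z]. *)
Lemma staircase (R : realFieldType) (N : nat) (z : R) : 0 <= z <= N%:R ->
  `|z - \sum_(k < N) (k.+1%:R <= z)%R%:R| <= 1.
Proof.
move=> /andP[z0 zN].
suff : let s := \sum_(k < N) (k.+1%:R <= z)%R%:R : R in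
    [/\ s <= z, s <= N%:R & z <= s + 1 \/ s = N%:R].
  by rewrite ler_norml /= => -[sz sN [zs|sE]]; apply/andP; split; lra.
move=> {zN} /=; elim: N => [|N [sz sN IH]].
  by rewrite big_ord0; split=> //; right.
rewrite big_ord_recr /=; move: sz sN IH; set s := \sum_(_ < _) _ => sz sN IH.
rewrite -natr1; have [Nz|zN] := leP (N%:R + 1) z.
  have sE : s = N%:R by case: IH => [zs|//]; lra.
  by rewrite sE; split=> //; right.
rewrite addr0; split=> //; first by lra.
by left; case: IH => [//|->]; lra.
Qed.

Section integral_functionals.
Context {R : realType} {d : measure_display} {T : measurableType d}.
Variables (lambda : probability T R) (sF : subsigma_algebra T).
Local Notation F := (subsigma_sets sF).
Local Notation m := (mass lambda).
Context {A : pmetricType R} (pi : cantor_space -> A).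
Hypotheses (piC : continuous pi) (piS : forall a, exists x, pi x = a).
Local Notation atom := (atom pi).

Variables (u : T * A -> R) (C : R).
Hypotheses (C0 : 0 < C) (uF : forall a r, F [set t | r <= u (t, a)])
  (uC : forall t, continuous (fun a => u (t, a)))
  (u_le : forall x, `|u x| <= C).

Lemma measurable_payoff f : measurable_fun setT (fun t => u (t, played pi f t)).
Proof.
have mu : measurable_fun setT (u : T * borel A -> R).
  apply: (measurable_caratheodory piC piS) => // a r.
  exact: subsigma_measurable (uF a r).
apply: (measurableT_comp mu); apply: measurable_fun_pair => //.
exact: measurable_played.
Qed.

Lemma integrable_payoff f :
  lambda.-integrable setT (EFin \o (fun t => u (t, played pi f t))).
Proof. by apply: (@bounded_integrable _ _ _ _ _ C) => //; exact: measurable_payoff. Qed.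

(** For each agent the payoff is uniformly continuous on the Cantor space, so
    words cut after [n] letters serve all agents but a set whose mass tends
    to 0.  The good sets are described through words padded by 0, which keeps
    them measurable. *)
Lemma uniform_discretization (e dl : R) : 0 < e -> 0 < dl ->
  exists n, exists2 E, measurable E /\ m (~` E) <= dl &
    forall t x, E t -> `|u (t, pi x) - u (t, atom (mkseq x n))| <= e.
Proof.
move=> e0 dl0; have e2 : 0 < e / 2 by rewrite divr_gt0.
pose D v w := [set t | `|u (t, atom v) - u (t, atom w)| <= e / 2].
pose E n := ~` \bigcup_(vw : seq bool * seq bool)
  (if `[< agree n (pad vw.1) (pad vw.2) >] then ~` D vw.1 vw.2 else set0).
have uT t : continuous (fun x : cantor_space => u (t, pi x)).
  by move=> x; apply: (@continuous_comp _ _ _ pi (fun a => u (t, a)) x); [exact: piC|exact: uC].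
have mD v w : measurable (D v w).
  have mu a : measurable_fun setT (fun t => u (t, a)).
    by apply: measurable_fun_superlevel => r; exact: subsigma_measurable (uF a r).
  have := measurable_funB (mu (atom v)) (mu (atom w)).
  move=> /(_ measurableT `[- (e / 2), e / 2]%classic (measurable_itv _)).
  rewrite setTI; congr (measurable _).
  by apply/seteqP; split=> t; rewrite /D /= in_itv/= ler_norml.
have mE n : measurable (E n).
  by apply/measurableC/countable_bigcupT_measurable => // vw; case: ifP => // _;
    exact: measurableC.
have EP n t : E n t <-> forall v w, agree n (pad v) (pad w) -> D v w t.
  split=> [Et v w vw|Et [[v w] _]]; last by case: asboolP => // /Et ? /(_ _).
  by apply: contrapT => nD; apply: Et; exists (v, w) => //=; rewrite asboolT.
have Ehomo : {homo E : n k / (n <= k)%N >-> n `<=` k}.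
  move=> n k nk t /EP Et; apply/EP => v w vw; apply: Et; exact: agree_le vw.
have ET : \bigcup_n E n = setT.
  apply/seteqP; split=> // t _; have [n nP] := uniform_agree (uT t) e2.
  by exists n => //; apply/EP => v w vw; exact: nP.
have := @mass_cvg _ _ _ lambda E mE Ehomo; rewrite ET massT.
move=> /cvgrPdist_le/(_ _ dl0)[n _ /(_ n (leqnn n))] /= mEn.
exists n, (E n); first split => //.
  rewrite (le_trans _ mEn)// (le_trans _ (ler_norm _))//.
  rewrite -(massT lambda) (massDI lambda measurableT (mE n)) setTI setTD.
  by rewrite addrC addKr.
move=> t x /EP Et; have [k kP] := uniform_agree (uT t) e2.
pose l := maxn n k.
have xl : agree l x (pad (mkseq x l)) by exact: agree_pad.
rewrite [leRHS]splitr.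
rewrite (le_trans (ler_distD (u (t, atom (mkseq x l))) _ _))// lerD//.
  by apply: kP; apply: agree_le xl; rewrite leq_maxr.
apply: Et => i ni; rewrite -xl ?(leq_trans ni) ?leq_maxl//.
by rewrite -agree_pad.
Qed.

Section step_function.
Variables (n N : nat).
Hypothesis N0 : (0 < N)%N.
Let h := 2 * C / N%:R.

Let N0R : 0 < N%:R :> R. Proof. by rewrite ltr0n. Qed.

Let h0 : 0 < h. Proof. by rewrite divr_gt0// mulr_gt0. Qed.

(** The payoff of the word [w] is written as [- C] plus the height [h] times the
    number of levels it reaches; the index [None] carries the constant. *)
Let coef (i : n.-tuple bool * option 'I_N) : R := if i.2 is Some k then h else - C.

Let level (i : n.-tuple bool * option 'I_N) : set T :=
  [set t | (if i.2 is Some k then - C + h * k.+1%:R else - C) <= u (t, atom i.1)].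

Let Flevel i : F (level i). Proof. exact: uF. Qed.

Definition step_mass (f : strategy T) : R :=
  \sum_i coef i * weight lambda f (tval i.1) (level i).

Lemma affine_continuous_step : affine_continuous lambda sF step_mass.
Proof.
by apply: affine_continuous_sum => i; apply: affine_continuous_weight.
Qed.

Let step (f : strategy T) t : R :=
  \sum_i coef i * \1_(cylinder f (tval i.1) `&` level i) t.

Let mstep (f : strategy T) i : measurable (cylinder f (tval i.1) `&` level i).
Proof.
apply: measurableI; first exact: measurable_cylinder.
exact: subsigma_measurable (Flevel i).
Qed.

Let step_dist (f : strategy T) t : `|u (t, atom (mkseq (f t) n)) - step f t| <= h.
Proof.
have sz : size (mkseq (f t) n) == n by rewrite size_mkseq.
set w0 : n.-tuple bool := Tuple sz.
have stepE : step f t = \sum_(o : option 'I_N) coef (w0, o) *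
    (\1_(level (w0, o)) t).
  rewrite /step -(pair_bigA _ (fun w o => coef (w, o) *
    \1_(cylinder f (tval w) `&` level (w, o)) t)) /=.
  rewrite (bigD1 w0)//= [X in _ + X]big1 ?addr0 => [|w ww0].
    apply: eq_bigr => o _; congr (_ * _); rewrite !indicE; congr (nat_of_bool _)%:R.
    apply/idP/idP => /set_mem lt; apply/mem_set; first by case: lt.
    by split=> //; rewrite /cylinder /= size_mkseq.
  apply: big1 => o _; rewrite indicE memNset ?mulr0// => -[wt _].
  by case/eqP: ww0; apply/val_inj; rewrite /= -wt size_tuple.
have bound := u_le (t, atom w0).
rewrite ler_norml in bound; case/andP: bound => lo hi.
have -> : step f t = - C + h * \sum_(k < N)
    (k.+1%:R <= (u (t, atom w0) + C) / h)%R%:R.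
  rewrite stepE (bigD1 None)//= indicE mem_set; last by rewrite /level /=.
  rewrite mulr1 mulr_sumr; congr (_ + _).
  rewrite (reindex_omap Some id) /=; last by case.
  apply: eq_big => [k|k _]; first by rewrite eqxx.
  rewrite indicE; congr (h * (nat_of_bool _)%:R).
  rewrite ler_pdivlMr// mulrC -lerBlDr [_ * _ - _]addrC.
  by apply/idP/idP => [/set_mem|kt]; [|apply/mem_set].
have zN : 0 <= (u (t, atom w0) + C) / h <= N%:R.
  have uC0 : 0 <= u (t, atom w0) + C by lra.
  rewrite (divr_ge0 uC0 (ltW h0))/=.
  rewrite ler_pdivrMr// /h mulrCA divff ?gt_eqF//; lra.
have := staircase zN; set s := \sum_(k < N) _.
have -> : u (t, atom (mkseq (f t) n)) - (- C + h * s) =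
    h * ((u (t, atom w0) + C) / h - s).
  by rewrite mulrBr mulrCA divff ?gt_eqF// mulr1 opprD opprK addrA.
move=> zs; rewrite normrM (gtr0_norm h0) -[leRHS]mulr1.
by rewrite ler_wpM2l// ltW.
Qed.

Lemma expect_step (e dl : R) (E : set T) (f : strategy T) :
  measurable E -> m (~` E) <= dl -> 0 <= e ->
  (forall t x, E t -> `|u (t, pi x) - u (t, atom (mkseq x n))| <= e) ->
  `|expect lambda (fun t => u (t, played pi f t)) - step_mass f| <=
    e + h + (2 * C + h) * dl.
Proof.
move=> mE mEdl e0 Ee.
have -> : step_mass f = expect lambda (step f).
  by rewrite /step expect_sum.
have h0' := ltW h0; have C0' := ltW C0.
apply: (le_trans (@expect_dist _ _ _ lambda _ _ E (e + h) (2 * C + h) _ _ _ _ _ _ _)) => //.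
- exact: integrable_payoff.
- exact: integrable_sum.
- by rewrite addr_ge0.
- by rewrite addr_ge0// mulr_ge0.
- move=> t Et; rewrite (le_trans (ler_distD (u (t, atom (mkseq (f t) n))) _ _))//.
  by rewrite lerD// Ee.
- move=> t; rewrite (le_trans (ler_distD (u (t, atom (mkseq (f t) n))) _ _))//.
  rewrite lerD//; rewrite (le_trans (ler_normB _ _))//.
  by have := u_le (t, played pi f t);
    have := u_le (t, atom (mkseq (f t) n)); lra.
by rewrite lerD2l ler_wpM2l// addr_ge0// mulr_ge0.
Qed.

End step_function.

(** Cutting words and rounding payoffs down to finitely many levels changes the
    integral by little, uniformly in the strategy, and turns it into a linear
    combination of weights. *)
Theorem affine_continuous_payoff : affine_continuous lambda sF
  (fun f => expect lambda (fun t => u (t, played pi f t))).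
Proof.
apply: affine_continuous_lim => e e0.
have e4 : 0 < e / 4 by rewrite divr_gt0.
have [N [N0 hN]] : exists N, (0 < N)%N /\ 2 * C / N%:R <= Num.min (e / 4) 1.
  have p0 : 0 < Num.min (e / 4) 1 by rewrite lt_min e4 ltr01.
  have [N NP] : exists N : nat, 2 * C / Num.min (e / 4) 1 < N%:R.
    by exists (Num.bound (2 * C / Num.min (e / 4) 1)); apply: archi_boundP;
      rewrite divr_ge0 ?mulr_ge0 ?ltW.
  have N0 : 0 < N%:R :> R.
    by apply: le_lt_trans NP; rewrite divr_ge0 ?mulr_ge0 ?ltW.
  exists N; split; first by rewrite -(ltr0n R).
  by rewrite ler_pdivrMr// -ler_pdivrMl// mulrC ltW.
have K0 : 0 < 2 * C + 1 by have := C0; lra.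
have dl0 : 0 < e / 4 / (2 * C + 1) by rewrite divr_gt0.
have [n [E [mE mEdl] Ee]] := uniform_discretization e4 dl0.
exists (@step_mass n N); first exact: affine_continuous_step.
move=> f; apply: (le_trans (expect_step N0 f mE mEdl (ltW e4) Ee)).
move: hN; rewrite le_min => /andP[hN h1].
have : (2 * C + 2 * C / N%:R) * (e / 4 / (2 * C + 1)) <= e / 4.
  rewrite mulrA ler_pdivrMr// mulrC ler_wpM2l ?(ltW e4)// lerD2l//.
move: (2 * C / N%:R) hN h1 => h hN h1 => {}h2.
by lra.
Qed.

End integral_functionals.

(** * Continuity of payoffs in the space of bounded continuous functions *)

Lemma bounded_fun_le (X : Type) (R : realType) (h : X -> R) :
  bounded_fun h -> exists2 C : R, 0 < C & forall x, `|h x| <= C.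
Proof.
move=> [M [_ hM]]; exists (`|M| + 1); first by rewrite ltr_wpDl.
by move=> x; apply: hM => //; rewrite (le_lt_trans (ler_norm M))// ltrDl.
Qed.

Lemma cvg_initial (Y : choiceType) (Z : topologicalType) (h : Y -> Z)
    (U : set_system Y) (y : Y) : Filter U -> h z @[z --> U] --> h y ->
  U --> (y : initial_topology h).
Proof.
move=> UF hU B [_ [[D Dop <-] Dy] DB].
have : nbhs (h y) D by exact: open_nbhs_nbhs.
move=> /hU hD; apply: (@filterS _ U UF (h @^-1` D)) => // z Dz; exact: DB.
Qed.

Section bcont_space.
Context {R : realType} {X : topologicalType}.
Implicit Types v w : bcont R X.

Lemma bcont_dist_ge v w x : `|v x - w x| <= mdist v w.
Proof.
apply: ub_le_sup; last by exists x.
have [C _ vC] := bounded_fun_le (bcont_bounded v).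
have [D _ wD] := bounded_fun_le (bcont_bounded w).
exists (C + D) => _ [z _ <-].
by rewrite (le_trans (ler_normB _ _))// lerD.
Qed.

Lemma continuous_bcont_eval x : continuous (fun v => v x).
Proof.
move=> v; apply/(@cvgrPdist_lt _ _ _ _ (@nbhs_filter (bcont R X) v)) => e e0.
apply/nbhs_ballP; exists e => //= w.
by rewrite ballEmdist /= => vw; exact: le_lt_trans (bcont_dist_ge v w x) vw.
Qed.

Lemma continuous_bcont_dist w : continuous (fun v => mdist v w).
Proof.
move=> v; apply/(@cvgrPdist_lt _ _ _ _ (@nbhs_filter (bcont R X) v)) => e e0.
apply/nbhs_ballP; exists e => //= v'.
rewrite ballEmdist /= => vv'; apply: le_lt_trans vv'.
have := metric_triangle v' v w; have := metric_triangle v v' w.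
rewrite (metric_sym v' v) => h1 h2; rewrite ler_norml; lra.
Qed.

End bcont_space.

(** * The game *)
Lemma ae_full (R : realType) d (T : measurableType d) (lambda : probability T R)
    (P : T -> Prop) (E : set T) : measurable E -> {ae lambda, forall t, P t} ->
  (forall t, P t -> E t) -> mass lambda E = 1.
Proof.
move=> mE [B [mB B0 PB]] PE; apply/eqP; rewrite eq_le mass_le1//=.
have mEC : measurable (~` E) by exact: measurableC.
rewrite -(massT lambda) (massDI lambda measurableT mE) setTI setTD.
rewrite gerDl (le_trans (le_mass lambda mEC mB _))//.
  by move=> t nE; apply: PB => Pt; apply: nE; exact: PE.
by rewrite /mass B0.
Qed.

Lemma countable_enum (X : pointedType) (C : set X) : countable C ->
  exists c : nat -> X, forall x, C x -> exists n, c n = x.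
Proof.
move=> /countable_injP[f finj].
have /choice[c cP] n : exists x, (exists y, C y /\ f y = n) -> C x /\ f x = n.
  have [[y Cy]|no] := pselect (exists y, C y /\ f y = n); first by exists y.
  by exists point.
exists c => x Cx; exists (f x); have [|Cc fc] := cP (f x); first by exists x.
by apply: finj; rewrite ?inE.
Qed.

Section game.
Context {R : realType} {d : measure_display} {T : measurableType d}.
Variables (lambda : probability T R) (sF : subsigma_algebra T).
Local Notation F := (subsigma_sets sF).
Local Notation m := (mass lambda).
Context {dS : measure_display} {S : measurableType dS} {A : pmetricType R}.
Hypotheses (NE : nowhere_equivalent lambda F) (cptA : compact [set: A]).
Variable G : large_game lambda sF S A.
Variable pi : cantor_space -> A.
Hypotheses (piC : continuous pi) (piS : forall a, exists x, pi x = a).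
Local Notation atom := (atom pi).
Local Notation played := (played pi).
Local Notation V := (bcont R (A * pmeasures S A)%type).

Definition action (f : strategy T) : {mfun T >-> borel A} :=
  HB.pack_for {mfun T >-> borel A} (played f)
    (isMeasurableFun.Build _ _ _ _ (played f) (measurable_played piC f)).

Definition law (f : strategy T) : pmeasures S A := action_law G (action f).

Lemma law_integral (phi : bounded_caratheodory S A) f :
  caratheodory_integral phi (law f) =
  expect lambda (fun t => sval phi (trait G t, played f t)).
Proof.
case: phi => phi [[mphi phiC] phib] /=.
have [C C0 phi_le] := bounded_fun_le phib.
have mphiS a r : measurable [set s | r <= phi (s, a)].
  have := mphi a measurableT `[r, +oo[%classic (measurable_itv _).
  rewrite setTI; congr (measurable _).
  by apply/seteqP; split=> s /=; rewrite in_itv/= andbT.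
have mp : measurable_fun setT (phi : S * borel A -> R).
  exact: (measurable_caratheodory piC piS).
rewrite /caratheodory_integral /expect /Rintegral; congr fine.
rewrite integral_distribution//; first exact/measurable_EFinP.
apply: (@bounded_integrable _ _ _ _ (phi \o trait_action G (action f)) C) => //.
  exact: measurableT_comp.
by move=> t; exact: phi_le.
Qed.

(** The topology on laws is tested on bounded functions of trait and action, whose
    integrals are payoff integrals of the strategy. *)
Lemma law_converges (U : set_system (strategy T)) f : Filter U ->
  converges lambda sF U f -> law h @[h --> U] --> law f.
Proof.
move=> UF Uf; apply/cvg_sup => phi.
apply: cvg_initial => //.
case: phi => phi [[mphi phiC] phib].
have [C C0 phi_le] := bounded_fun_le phib.
rewrite [X in _ --> X]law_integral.
rewrite (_ : fmap _ _ = expect lambda (fun t => phi (trait G t, played h t))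
    @[h --> U]); last first.
  by rewrite -fmap_comp; congr (fmap _ U); apply/funext => h; exact: law_integral.
have [|||PsiC _] := @affine_continuous_payoff _ _ _ lambda sF _ _ piC piS
    (fun x : T * A => phi (trait G x.1, x.2)) C C0.
- move=> a r; have := mphi a measurableT `[r, +oo[%classic (measurable_itv _).
  rewrite setTI => /(trait_measurable G); congr F.
  by apply/seteqP; split=> s /=; rewrite in_itv/= andbT.
- by move=> t a; exact: phiC.
- by move=> x; exact: phi_le.
exact: PsiC.
Qed.

(** Dividing the payoff function of an agent by 1 plus its sup norm makes payoffs
    uniformly bounded without changing best replies. *)
Definition payoff_scale (v : V) : R := (1 + mdist v point)^-1.

Lemma payoff_scale_gt0 v : 0 < payoff_scale v.
Proof. by rewrite invr_gt0 ltr_pwDl// mdist_ge0. Qed.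

Lemma payoff_scale_le1 v : payoff_scale v <= 1.
Proof. by rewrite invf_le1 ?ltr_pwDl ?mdist_ge0// lerDl mdist_ge0. Qed.

Definition score (rho : pmeasures S A) (x : T * A) : R :=
  payoff_scale (payoff G x.1) * payoff G x.1 (x.2, rho).

Lemma score_le1 rho x : `|score rho x| <= 1.
Proof.
rewrite /score normrM (gtr0_norm (payoff_scale_gt0 _)) mulrC ler_pdivrMr; last first.
  by rewrite ltr_pwDl// mdist_ge0.
have := bcont_dist_ge (payoff G x.1) point (x.2, rho).
rewrite mul1r /= subr0 => h; rewrite (le_trans h)// lerDr//.
Qed.

Lemma score_superlevel rho a r : F [set t | r <= score rho (t, a)].
Proof.
have psiC : continuous (fun v : V => payoff_scale v * v (a, rho)).
  move=> v; have Fv : Filter (nbhs v) := nbhs_filter v.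
  apply: cvgM; last exact: continuous_bcont_eval.
  apply: cvgV; first by rewrite gt_eqF// ltr_pwDl// mdist_ge0.
  by apply: cvgD; [exact: cvg_cst|exact: continuous_bcont_dist].
have mB : measurable ([set v : V | r <= payoff_scale v * v (a, rho)] : set (borel V)).
  rewrite -[X in measurable X]setCK; apply: measurableC.
  apply: sub_sigma_algebra; apply: closed_openC.
  by apply: (preimage_closed _ (@closed_ge _ r)) => v _; exact: psiC.
exact: (payoff_measurable G mB).
Qed.

Lemma score_continuous rho t : continuous (fun a => score rho (t, a)).
Proof.
move=> a; have Fa : Filter (nbhs a) := nbhs_filter a.
rewrite /score /=; apply: cvgMl_tmp.
have pairC : (b, rho) @[b --> a] --> (a, rho).
  have Fr : Filter (nbhs rho) := nbhs_filter rho.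
  exact: (cvg_pair (@cvg_id _ _) (@cvg_cst _ _ _ _ Fa)).
exact: (cvg_comp _ _ pairC (@bcont_continuous _ _ (payoff G t) (a, rho))).
Qed.

Definition value (f h : strategy T) : R :=
  expect lambda (fun t => score (law f) (t, played h t)).

Lemma affine_continuous_value f : affine_continuous lambda sF (value f).
Proof.
exact: (@affine_continuous_payoff _ _ _ lambda sF _ _ piC piS
  (score (law f)) 1 ltr01 (score_superlevel _) (@score_continuous _)
  (score_le1 _)).
Qed.

Lemma integrable_score rho f :
  lambda.-integrable setT (EFin \o (fun t => score rho (t, played f t))).
Proof.
exact: (@integrable_payoff _ _ _ lambda sF _ _ piC piS (score rho) 1
  (score_superlevel _) (@score_continuous _) (score_le1 _)).
Qed.

(** The tube lemma on [A] times the space of laws. *)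
Lemma tube (c : V) (U : set_system (strategy T)) f (e : R) : Filter U ->
  converges lambda sF U f -> 0 < e ->
  \forall h \near U, forall a, `|c (a, law h) - c (a, law f)| <= e.
Proof.
move=> UF Uf e0.
have /compact_near_coveringP/(_ _ U
  (fun h a => `|c (a, law h) - c (a, law f)| <= e) UF) := cptA.
have cover (a : A) : setT a -> \forall a' \near a & h \near U,
    `|c (a', law h) - c (a', law f)| <= e.
  move=> _; have e2 : 0 < e / 2 by rewrite divr_gt0.
  have /cvgrPdist_le/(_ _ e2)[[Q1 Q2] /= [Qa Qf] QB] :=
    @bcont_continuous _ _ c (a, law f).
  exists (Q1, law @^-1` Q2); first by split=> //; exact: (law_converges UF Uf).
  move=> [a' h] /= [Qa' Qh].
  have h1 := QB (a', law h) (conj Qa' Qh).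
  have h2 := QB (a', law f) (conj Qa' (nbhs_singleton Qf)).
  rewrite [leRHS]splitr (le_trans (ler_distD (c (a, law f)) _ _))// lerD//.
  by rewrite distrC.
by move=> /(_ cover); apply: filterS => h hP a; exact: hP.
Qed.

Lemma payoff_enum : exists c : nat -> V,
  {ae lambda, forall t, forall e : R, 0 < e -> exists n, mdist (payoff G t) (c n) < e}.
Proof.
have [w [wP wcvg]] := payoff_strongly_measurable G.
have /choice[c cP] n : exists c : nat -> V, forall t, exists k, c k = w n t.
  have [c cP] := countable_enum (wP n).2.
  by exists c => t; apply: cP; exists t.
exists (fun j => if unpickle j is Some nk then c nk.1 nk.2 else point).
apply: filterS wcvg => t wt e e0.
have : \forall v \near payoff G t, mdist (payoff G t) v < e.
  by apply/nbhs_ballP; exists e => //= v; rewrite ballEmdist.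
move=> /wt[n _ /(_ n (leqnn n))] /= wn.
have [k ck] := cP n t.
by exists (pickle (n, k)); rewrite pickleK /= ck.
Qed.

(** Strong measurability: almost every payoff function is a limit of members of a
    countable family, so finitely many members come close to the payoff functions
    of all agents but a set of small mass. *)
Lemma payoff_covered (e dl : R) : 0 < e -> 0 < dl ->
  exists N (c : nat -> V) E, [/\ measurable E, m (~` E) <= dl &
    forall t, E t -> exists2 n, (n < N)%N & mdist (payoff G t) (c n) < e].
Proof.
move=> e0 dl0; have [c cP] := payoff_enum.
pose E N := [set t | exists2 n, (n < N)%N & mdist (payoff G t) (c n) < e].
have mE N : measurable (E N).
  rewrite (_ : E N = \bigcup_(n in `I_N) [set t | mdist (payoff G t) (c n) < e]).
    apply: fin_bigcup_measurable => // n _.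
    have mB : measurable ([set v : V | mdist v (c n) < e] : set (borel V)).
      apply: sub_sigma_algebra; rewrite openE => v /= ve.
      have Fv : Filter (nbhs v) := nbhs_filter v.
      exact: (cvgr_lt _ (@continuous_bcont_dist _ _ (c n) v)).
    exact: subsigma_measurable (payoff_measurable G mB).
  by apply/seteqP; split=> t [n nN tn]; exists n.
have Ehomo : {homo E : n k / (n <= k)%N >-> n `<=` k}.
  by move=> n k nk t [j jn tj]; exists j => //; exact: leq_trans nk.
have EU : m (\bigcup_n E n) = 1.
  apply: (ae_full _ cP); first exact: bigcup_measurable.
  by move=> t /(_ e e0)[n tn]; exists n.+1 => //; exists n.
have := @mass_cvg _ _ _ lambda E mE Ehomo; rewrite EU.
move=> /cvgrPdist_le/(_ _ dl0)[N _ /(_ N (leqnn N))] /= mEN.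
exists N, c, (E N); split=> //.
rewrite (le_trans _ mEN)// (le_trans _ (ler_norm _))//.
rewrite -(massT lambda) (massDI lambda measurableT (mE N)) setTI setTD.
by rewrite addrC addKr.
Qed.

(** On the agents covered by finitely many payoff functions, [tube] bounds the
    change for all actions at once; the others are few and have bounded scores.
    The error is 3/5 of [e] on the former and at most 2/5 of [e] on the latter. *)
Lemma value_equicontinuous (U : set_system (strategy T)) f (e : R) : Filter U ->
  converges lambda sF U f -> 0 < e ->
  \forall h \near U, forall g, `|value h g - value f g| <= e.
Proof.
move=> UF Uf e0; have e5 : 0 < e / 5 by rewrite divr_gt0.
have [N [c [E [mE mEdl EP]]]] := payoff_covered e5 e5.
have near_all : \forall h \near U, forall n, (n < N)%N ->
    forall a, `|c n (a, law h) - c n (a, law f)| <= e / 5.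
  elim: N {E mE mEdl EP} => [|N IH]; first by apply: filterE.
  apply: filterS2 IH (tube (c N) UF Uf e5) => h IH hN n.
  by rewrite ltnS leq_eqVlt => /predU1P[->//|]; exact: IH.
apply: filterS near_all => h hP g.
apply: (le_trans (@expect_dist _ _ _ lambda _ _ E (3 * (e / 5)) 2
  (integrable_score _ _) (integrable_score _ _) mE _ _ _ _)) => //.
- by rewrite mulr_ge0// ltW.
- move=> t Et; have [n nN vc] := EP t Et; have {}hP := hP n nN (played g t).
  rewrite /score /= -mulrBr normrM (gtr0_norm (payoff_scale_gt0 _)).
  apply: (le_trans (ler_piMl (normr_ge0 _) (payoff_scale_le1 _))).
  set v := payoff G t in vc *.
  have h1 := le_trans (bcont_dist_ge v (c n) (played g t, law h)) (ltW vc).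
  have h2 := le_trans (bcont_dist_ge v (c n) (played g t, law f)) (ltW vc).
  move: hP h1 h2; rewrite !ler_norml => /andP[? ?] /andP[? ?] /andP[? ?].
  by apply/andP; split; lra.
- move=> t; rewrite (le_trans (ler_normB _ _))//.
  by have := score_le1 (law h) (t, played g t);
    have := score_le1 (law f) (t, played g t); lra.
lra.
Qed.

Lemma equilibrium_strategy : exists f, forall h, value f h <= value f f.
Proof.
have f0 : strategy T.
  apply: (@Strategy _ _ (fun _ _ => false)) => n.
  by rewrite (_ : mkset _ = set0)//; apply/seteqP; split.
apply: (@compact_convex_equilibrium R _ f0 (converges lambda sF)).
- by move=> U UU; exact: (ultra_converges NE UU).
- move=> U f PU Uf; have UF : Filter U by exact: filter_filter.
  have close h : value g h @[g --> U] --> value f h.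
    apply/cvgrPdist_le => e e0.
    by apply: filterS (value_equicontinuous UF Uf e0) => g gP; rewrite distrC.
  split=> //; apply/cvgrPdist_le => e e0; have e2 : 0 < e / 2 by rewrite divr_gt0.
  have /cvgrPdist_le/(_ _ e2) := (affine_continuous_value f).1 U f UF Uf.
  apply: filterS2 (value_equicontinuous UF Uf e2) => g gP gf.
  rewrite [leRHS]splitr (le_trans (ler_distD (value f g) _ _))// lerD//.
  by rewrite distrC.
- move=> n h.
  have /choice[mix mixP] (x : 'rV[R]_n.+1) : exists f,
      simplex x -> mixture lambda sF x h f.
    have [xS|nS] := pselect (simplex x); last by exists f0 => /nS.
    by have [f fP] := mixture_exists NE h xS; exists f.
  exists mix => x xS; split; first exact: (continuous_mixture mixP xS).
  by move=> f; exact: ((affine_continuous_value f).2 _ _ _ _ xS (mixP x xS)).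
Qed.

(** The deviation that follows [pad w] exactly where this is strictly better has
    a nonnegative gain with nonpositive integral, so the gain is null. *)
Lemma equilibrium_pure_nash f : (forall h, value f h <= value f f) ->
  pure_nash G (action f).
Proof.
move=> fmax; pose rho := law f.
have best w : {ae lambda, forall t,
    score rho (t, atom w) <= score rho (t, played f t)}.
  pose E := [set t | score rho (t, played f t) < score rho (t, atom w)].
  have mf : measurable_fun setT (fun t => score rho (t, played f t)).
    exact/measurable_EFinP/measurable_int/(integrable_score rho f).
  have mw : measurable_fun setT (fun t => score rho (t, atom w)).
    apply: measurable_fun_superlevel => r.
    exact: subsigma_measurable (score_superlevel rho (atom w) r).
  have mE : measurable E.
    have /(_ measurableT [set true] I) := measurable_fun_ltr mf mw.
    by rewrite setTI; congr (measurable _); apply/seteqP; split.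
  pose h0 t := if t \in E then pad w else path_of f t.
  have mh n : measurable [set t | h0 t n].
    rewrite (_ : mkset _ = (E `&` [set _ | pad w n]) `|` ([set t | f t n] `\` E)).
      apply: measurableU; last first.
        by apply: measurableD => //; exact: measurable_path.
      apply: measurableI => //; case: (pad w n).
        by rewrite (_ : mkset _ = setT)//; apply/seteqP; split.
      by rewrite (_ : mkset _ = set0)//; apply/seteqP; split.
    apply/seteqP; split=> t; rewrite /= /h0.
      by case: ifPn => [/set_mem|/negP tE] ?; [left|right; split=> // /mem_set].
    by move=> [[/mem_set->]//|[tn tE]]; rewrite memNset.
  pose h := Strategy mh.
  pose gain t := score rho (t, played h t) - score rho (t, played f t).
  have gainE t : gain t = if t \in E then
      score rho (t, atom w) - score rho (t, played f t) else 0.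
    rewrite /gain /played /= /h0; case: ifP => // _.
    by rewrite subrr.
  have gain0 t : 0 <= gain t.
    by rewrite gainE; case: ifPn => // /set_mem /ltW; rewrite subr_ge0.
  have ig : lambda.-integrable setT (EFin \o gain).
    apply: eq_integrable (integrableB measurableT (integrable_score rho h)
      (integrable_score rho f)) => //.
  have gain_null : (\int[lambda]_t `|(gain t)%:E| = 0)%E.
    have le0 : expect lambda gain <= 0.
      rewrite /expect /gain RintegralB//; [|exact: integrable_score..].
      by rewrite subr_le0; exact: fmax.
    apply/eqP; rewrite eq_le integral_ge0// andbT.
    under eq_integral do rewrite gee0_abs ?lee_fin//.
    have fin : (\int[lambda]_t (gain t)%:E)%E \is a fin_num.
      exact: integrable_fin_num.
    by rewrite -(fineK fin) lee_fin.
  have mg : measurable_fun setT (EFin \o gain) by exact: measurable_int ig.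
  have /(ae_eq_integral_abs lambda measurableT mg) := gain_null.
  apply: filterS => t /(_ I) /= [] gt0; rewrite leNgt; apply/negP => tE.
  move: gt0; rewrite gainE mem_set// => /eqP; rewrite subr_eq0 => /eqP eq_t.
  by rewrite eq_t ltxx in tE.
have all_best : {ae lambda, forall t, forall w,
    score rho (t, atom w) <= score rho (t, played f t)}.
  pose word n : seq bool := odflt [::] (unpickle n).
  have := @ae_foralln _ _ _ lambda _ (fun n => best (word n)).
  by apply: filterS => t tP w; have := tP (pickle w); rewrite /word pickleK.
apply: filterS all_best => t tP a.
have {}tP w : payoff G t (atom w, rho) <= payoff G t (played f t, rho).
  by have := tP w; rewrite /score /= ler_pM2l// payoff_scale_gt0.
rewrite leNgt; apply/negP => lt_a.
have : \forall b \near a, score rho (t, played f t) < score rho (t, b).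
  apply: cvgr_gt (@score_continuous rho t a) _ _.
  by rewrite /score /= ltr_pM2l// payoff_scale_gt0.
move=> /(dense_atom piC piS)[w].
by rewrite /= /score /= ltr_pM2l ?payoff_scale_gt0// ltNge tP.
Qed.

End game.

Theorem theorem5 (R : realType)
    (d : measure_display) (T : measurableType d) (lambda : probability T R)
    (F : subsigma_algebra T) (A : pmetricType R)
    (dS : measure_display) (S : measurableType dS)
    (complete_lambda : measure_is_complete lambda)
    (atomless_lambda : atomless lambda)
    (compact_A : compact [set: A])
    (nowhere_equivalent_F : nowhere_equivalent lambda F)
    (G : large_game lambda F S A) :
  exists f : {mfun T >-> borel A}, pure_nash G f.
Proof.
have [pi piC] := cantor_surj compact_A (@metric_hausdorff R A).
have piS a : exists x, pi x = a.
  by have [x _ <-] := @surj _ _ _ _ pi a I; exists x.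
have [f fmax] := equilibrium_strategy nowhere_equivalent_F compact_A G piC piS.
by exists (action piC f); exact: equilibrium_pure_nash.
Qed.
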